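(* There is a minimal Turing degree $\mathbf{a}>\mathbf{0}$ such that no Turing degree $\mathbf{b}$ with $\mathbf{0}<\mathbf{b}\le\mathbf{a}$ belongs to $\mathbf{LFS}^*$; that is, no non-computable set computable from a set of degree $\mathbf{a}$ is low for speed.
   Context: A Turing degree $\mathbf{a}>\mathbf{0}$ is minimal if there is no degree strictly between $\mathbf{0}$ and $\mathbf{a}$. Oracles are languages $X\subseteq\{0,1\}^*$, identified with subsets of $\mathbb{N}$ and with infinite binary sequences. Oracle computations are measured in the usual complexity-theoretic model: the machine has a query tape, and once a string $x$ is written on it, the answer to ''is $x\in X$?'' is obtained in time $O(1)$. An oracle $X$ is \emph{low for speed} if for every computable (decidable) language $L$: whenever some oracle Turing machine $M$ with oracle $X$ decides $L$ within time bound $f$ (i.e. $time(M^X,x)\le f(x)$ for all inputs $x$), there exist a Turing machine $M'$ without oracle and a polynomial $p$ such that $M'$ decides $L$ within time bound $p\circ f$. $\mathbf{LFS}^*$ denotes the set of Turing degrees containing at least one non-computable low for speed set. *)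

(* Defs.v *)
From mathcomp Require Import all_boot.
Set Implicit Arguments. Unset Strict Implicit. Unset Printing Implicit Defensive.

Definition word := seq bool.
Definition lang := word -> bool.

(* Tape symbols: Some b = bit b, None = blank. *)
Definition sym := option bool.

Inductive move := MoveL | MoveS | MoveR.

(* Semi-infinite tape: (cells left of the head, reversed ; cells from the head on).
   Cells beyond the stored lists are blank. *)
Definition tape := (seq sym * seq sym)%type.

Definition tape_read (t : tape) : sym := head None t.2.
Definition tape_write (s : sym) (t : tape) : tape := (t.1, s :: behead t.2).
Definition tape_move (m : move) (t : tape) : tape :=
  match m with
  | MoveS => t
  | MoveR => (head None t.2 :: t.1, behead t.2)
  | MoveL => match t.1 with [::] => t | a :: l => (l, a :: t.2) end
  end.

Fixpoint bits_prefix (s : seq sym) : word :=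
  match s with Some b :: s' => b :: bits_prefix s' | _ => [::] end.
Definition tape_word (t : tape) : word := bits_prefix (rev t.1 ++ t.2).

(* An oracle Turing machine with finitely many states [ns] and [nw.+2] tapes:
   tape 0 is the input tape, tape 1 is the query tape, the others are work tapes.
   In state [q_query] the machine, in one step, passes to [q_yes] or [q_no]
   according to whether the word on the query tape belongs to the oracle.
   [q_acc] / [q_rej] are halting states. *)
Record OTM := {
  nw : nat;
  ns : nat;
  q_start : 'I_ns; q_query : 'I_ns; q_yes : 'I_ns; q_no : 'I_ns;
  q_acc : 'I_ns; q_rej : 'I_ns;
  delta : 'I_ns -> {ffun 'I_(nw.+2) -> sym} ->
          'I_ns * {ffun 'I_(nw.+2) -> (sym * move)}
}.

Definition config (M : OTM) := ('I_(ns M) * ('I_((nw M).+2) -> tape))%type.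

Definition query_tape (M : OTM) : 'I_((nw M).+2) := lift ord0 ord0.

Definition halted (M : OTM) (c : config M) : bool :=
  (c.1 == q_acc M) || (c.1 == q_rej M).

Definition step (M : OTM) (X : lang) (c : config M) : config M :=
  if halted c then c
  else if c.1 == q_query M then
    ((if X (tape_word (c.2 (query_tape M))) then q_yes M else q_no M), c.2)
  else
    let r := [ffun i => tape_read (c.2 i)] in
    let qa := delta c.1 r in
    (qa.1, fun i => tape_move (qa.2 i).2 (tape_write (qa.2 i).1 (c.2 i))).

Definition init (M : OTM) (x : word) : config M :=
  (q_start M, fun i => if i == ord0 then ([::], map Some x) else ([::], [::])).

Definition run (M : OTM) (X : lang) (x : word) (t : nat) : config M :=
  iter t (@step M X) (init M x).

Definition outputs_within (M : OTM) (X : lang) (x : word) (t : nat) (b : bool) : Prop :=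
  halted (@run M X x t) /\ ((@run M X x t).1 == q_acc M) = b.

Definition decides (M : OTM) (X : lang) (L : lang) : Prop :=
  forall x, exists t, outputs_within M X x t (L x).

Definition decides_within (M : OTM) (X : lang) (L : lang) (f : word -> nat) : Prop :=
  forall x, outputs_within M X x (f x) (L x).

(* A machine without oracle = an OTM run with the empty oracle
   (its queries always get the answer "no", so they are useless). *)
Definition no_oracle : lang := fun _ => false.

Definition computable (L : lang) : Prop := exists M, decides M no_oracle L.

Definition treducible (A B : lang) : Prop := exists M, decides M B A.
Definition tequiv (A B : lang) : Prop := treducible A B /\ treducible B A.

Definition peval (cs : seq nat) (n : nat) : nat :=
  \sum_(i < size cs) nth 0 cs i * n ^ i.

Definition low_for_speed (X : lang) : Prop :=
  forall L : lang, computable L ->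
  forall (M : OTM) (f : word -> nat), decides_within M X L f ->
  exists (M' : OTM) (cs : seq nat),
    decides_within M' no_oracle L (fun x => peval cs (f x)).

Definition degree_in_LFSstar (B : lang) : Prop :=
  exists C : lang, tequiv C B /\ ~ computable C /\ low_for_speed C.

Definition minimal_degree (A : lang) : Prop :=
  ~ computable A /\ forall B : lang, treducible B A -> computable B \/ treducible A B.

(* Main.v *)
Require Import Defs.
From mathcomp Require Import all_boot.
From mathcomp Require Import zify.
From Stdlib Require Import Classical ClassicalEpsilon FunctionalExtensionality.
Set Implicit Arguments. Unset Strict Implicit. Unset Printing Implicit Defensive.

(** The degree is built by forcing with computable perfect trees, a tree being a computable
    Lipschitz injection of Cantor space into itself. Given a tree and a machine [M], either
    [M] diverges at some word on a subtree, or its value is constant on a subtree, hence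
    comp_auto, or there is a subtree on which [M] is total and splits at every level. In the
    last case the branch [Z] is computable from the set [B_Z] computed by [M], uniformly, which
    gives minimality. It also gives a single machine [N] which, with oracle [B_Z], answers a
    word [w] by the bit of [Z] at position [2 num w]. By compactness [N] halts on [w] within a
    comp_auto time [S w] that does not depend on [Z]. Let [L w] be the opposite of the answer
    of the [w]-th oracle-free machine after polynomially many steps in [S w], and thin the tree
    by requiring the bit of [Z] at position [2 num w] to be [L w]. Then [L] is computable, [N]
    decides it in time [S] from [B_Z], and no machine without oracle does so in time polynomial
    in [S], so [B_Z] is not low for speed. *)

(** * Bit-stack programs and their machine code *)

(** The bound [S] must be known before the branch is chosen, since [L] has to be computable although
    the oracle is not. Hence the calculus of programs treats families of oracles: [Comp] asks for
    one program that serves every member, so that [N] is one machine for all branches and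
    compactness applies to it. The diagonalisation costs [N] nothing: its answer is a bit of the
    parameter, and the tree, not the machine, is made to supply [L]; the time needed to compute [L]
    never enters. The factor two leaves the odd positions to the old parameter, so the thinned map
    is still injective. The choice between divergence, constancy and splitting is classical; only
    the maps that result have to be computable. With one output bit per input bit, all composites of
    trees have the same form, and a delay of one bit at each stage makes the infinite composition
    converge. Running times of programs are never estimated: machines are only shown to halt, and
    [S] is found by a search over simulations. *)

Definition stk := seq (seq bool).
Notation peek st i := (nth [::] st (nat_of_ord i)).
Notation poke st i s := (set_nth [::] st (nat_of_ord i) s).

(** One loop form serves two uses: with flag [true] it runs until the stack is empty; with flag
    [false] a popped [false] ends it after one run of [c0], as in a while loop on a Boolean. *)
Inductive cmd :=
| Skip
| Push of 'I_5 & bool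
| Seq of cmd & cmd
| Case of 'I_5 & cmd & cmd & cmd
| Loop of 'I_5 & bool & cmd & cmd
| Query of cmd & cmd.

Definition sQ : 'I_5 := @Ordinal 5 0 isT.
Definition sS : 'I_5 := @Ordinal 5 1 isT.
Definition sT : 'I_5 := @Ordinal 5 2 isT.
Definition sU : 'I_5 := @Ordinal 5 3 isT.
Definition sC : 'I_5 := @Ordinal 5 4 isT.

Inductive exec (X : lang) : cmd -> stk -> stk -> Prop :=
| ESkip st : exec X Skip st st
| EPush i b st : exec X (Push i b) st (poke st i (b :: peek st i))
| ESeq c d st1 st2 st3 :
    exec X c st1 st2 -> exec X d st2 st3 -> exec X (Seq c d) st1 st3
| ECaseE i ce c0 c1 st st' :
    peek st i = [::] -> exec X ce st st' -> exec X (Case i ce c0 c1) st st'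
| ECase i ce c0 c1 b r st st' :
    peek st i = b :: r -> exec X (if b then c1 else c0) (poke st i r) st' ->
    exec X (Case i ce c0 c1) st st'
| ELoopE i z c0 c1 st : peek st i = [::] -> exec X (Loop i z c0 c1) st st
| ELoopGo i z c0 c1 b r st st1 st2 :
    peek st i = b :: r -> b || z ->
    exec X (if b then c1 else c0) (poke st i r) st1 ->
    exec X (Loop i z c0 c1) st1 st2 -> exec X (Loop i z c0 c1) st st2
| ELoopStop i c0 c1 r st st1 :
    peek st i = false :: r -> exec X c0 (poke st i r) st1 ->
    exec X (Loop i false c0 c1) st st1
| EQuery cy cn st st' :
    exec X (if X (rev (peek st sQ)) then cy else cn) st st' ->
    exec X (Query cy cn) st st'.

Inductive instr :=
| IPush of 'I_5 & bool & nat
| IPop of 'I_5 & nat & nat & nat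
| IQuery of nat & nat
| IHalt of bool.

(* [asm c k off] returns the entry label and the code of [c], placed from address [off] on,
   with exit label [k]. *)
Fixpoint asm (c : cmd) (k off : nat) : nat * seq instr :=
  match c with
  | Skip => (k, [::])
  | Push i b => (off, [:: IPush i b k])
  | Seq c d =>
      let q := asm d k off in
      let p := asm c q.1 (off + size q.2) in
      (p.1, q.2 ++ p.2)
  | Case i ce c0 c1 =>
      let qe := asm ce k off.+1 in
      let q0 := asm c0 k (off.+1 + size qe.2) in
      let q1 := asm c1 k (off.+1 + size qe.2 + size q0.2) in
      (off, IPop i qe.1 q0.1 q1.1 :: qe.2 ++ q0.2 ++ q1.2)
  | Loop i z c0 c1 =>
      let q0 := asm c0 (if z then off else k) off.+1 in
      let q1 := asm c1 off (off.+1 + size q0.2) in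
      (off, IPop i k q0.1 q1.1 :: q0.2 ++ q1.2)
  | Query cy cn =>
      let qy := asm cy k off.+1 in
      let qn := asm cn k (off.+1 + size qy.2) in
      (off, IQuery qy.1 qn.1 :: qy.2 ++ qn.2)
  end.

Definition code_at (P : seq instr) (off : nat) (c : seq instr) :=
  forall j ins, onth c j = Some ins -> onth P (off + j) = Some ins.

Lemma onth_cons_cat (T : Type) (s1 s2 : seq T) j :
  onth (s1 ++ s2) j = if j < size s1 then onth s1 j else onth s2 (j - size s1).
Proof. by elim: s1 j => [|x s1 IH] [|j] //=; rewrite ?subn0 // IH ltnS subSS. Qed.

Lemma code_at_cat P off c d :
  code_at P off (c ++ d) -> code_at P off c /\ code_at P (off + size c) d.
Proof.
move=> H; split=> j ins E.
  apply: H; rewrite onth_cons_cat; case: ltnP => // le.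
  by rewrite onth_default in E.
rewrite -addnA; apply: H; rewrite onth_cons_cat ltnNge leq_addr /=.
by rewrite addnC addnK.
Qed.

Lemma code_at_cons P off a d :
  code_at P off (a :: d) -> onth P off = Some a /\ code_at P off.+1 d.
Proof.
move=> H; split; first by rewrite -[off]addn0; apply: H.
by move=> j ins E; rewrite addSnnS; apply: H.
Qed.

Definition sconf := (nat * stk)%type.

Inductive sstep (P : seq instr) (X : lang) : sconf -> sconf -> Prop :=
| SPush pc i b l st : onth P pc = Some (IPush i b l) ->
    sstep P X (pc, st) (l, poke st i (b :: peek st i))
| SPopE pc i le l0 l1 st : onth P pc = Some (IPop i le l0 l1) -> peek st i = [::] ->
    sstep P X (pc, st) (le, st)
| SPop pc i le l0 l1 b r st : onth P pc = Some (IPop i le l0 l1) -> peek st i = b :: r ->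
    sstep P X (pc, st) (if b then l1 else l0, poke st i r)
| SQuery pc ly ln st : onth P pc = Some (IQuery ly ln) ->
    sstep P X (pc, st) (if X (rev (peek st sQ)) then ly else ln, st).

Inductive star (T : Type) (R : T -> T -> Prop) : T -> T -> Prop :=
| star0 x : star R x x
| starS x y z : R x y -> star R y z -> star R x z.

Lemma star_trans (T : Type) (R : T -> T -> Prop) x y z :
  star R x y -> star R y z -> star R x z.
Proof. by move=> H; elim: H z => // {}x {}y w Rxy _ IH z /IH; apply: starS. Qed.

Lemma asm_correct P X c st st' : exec X c st st' ->
  forall k off, code_at P off (asm c k off).2 ->
  star (sstep P X) ((asm c k off).1, st) (k, st').
Proof.
elim=> {c st st'}.
- by move=> st k off _; apply: star0.
- move=> i b st k off /= /code_at_cons[E _].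
  by apply: starS (star0 _ _); apply: SPush.
- move=> c d st1 st2 st3 _ IHc _ IHd k off /= /code_at_cat[Hd Hc].
  exact: star_trans (IHc _ _ Hc) (IHd _ _ Hd).
- move=> i ce c0 c1 st st' E _ IH k off /= /code_at_cons[E0 /code_at_cat[He _]].
  by apply: starS (IH _ _ He); apply: SPopE E0 E.
- move=> i ce c0 c1 b r st st' E _ IH k off /=.
  move=> /code_at_cons[E0 /code_at_cat[_ /code_at_cat[H0 H1]]].
  apply: starS (SPop _ E0 E) _.
  by case: b {E} IH => IH; apply: IH.
- move=> i z c0 c1 st E k off /= /code_at_cons[E0 _].
  by apply: starS (star0 _ _); apply: SPopE E0 E.
- move=> i z c0 c1 b r st st1 st2 E bz _ IH1 _ IH2 k off H.
  have {}IH2 := IH2 k off H.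
  move: H => /= /code_at_cons[E0 /code_at_cat[H0 H1]].
  apply: starS (SPop _ E0 E) _.
  apply: star_trans IH2.
  case: b {E} bz IH1 => [_|] /= IH1; first exact: IH1.
  (* The popped bit is [false] and [IH1] says that the loop flag is [true], so the exit label of
     [c0] is the loop head. *)
  by move=> IH; rewrite IH1 in H0 *; apply: IH.
- move=> i c0 c1 r st st1 E _ IH k off /= /code_at_cons[E0 /code_at_cat[H0 _]].
  by apply: starS (SPop _ E0 E) _; apply: IH.
- move=> cy cn st st' _ IH k off /= /code_at_cons[E0 /code_at_cat[Hy Hn]].
  apply: starS (SQuery _ _ E0) _.
  by move: IH; case: (X _) => IH; apply: IH.
Qed.

(** * From machine code to oracle Turing machines *)

Section Assemble.
Variables (P : seq instr) (entry : nat).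
Let n := (size P).+1.
Let ntapes := (4 + n).+2.

(** Stack [sQ] lies on tape 1, the query tape, so a query requires no copying. *)
Definition tidx (i : 'I_5) : 'I_ntapes := @lift (5 + n).+1 ord0 (lshift n i).
Definition fidx (p : 'I_n) : 'I_ntapes := @lift (5 + n).+1 ord0 (rshift 5 p).

Lemma tidx_eq i j : (tidx i == tidx j) = (i == j).
Proof. by rewrite -!(inj_eq val_inj) /= /bump /= eqn_add2l. Qed.

Lemma fidx_eq i j : (fidx i == fidx j) = (i == j).
Proof. by rewrite -!(inj_eq val_inj) /= /bump /= !eqn_add2l. Qed.

Lemma tidx_fidx i j : (tidx i == fidx j) = false.
Proof. by rewrite -!(inj_eq val_inj) /= /bump /= eqn_add2l ltn_eqF // ltn_addr. Qed.

Lemma fidx_tidx i j : (fidx i == tidx j) = false.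
Proof. by rewrite eq_sym tidx_fidx. Qed.

(* [inl (false, pc)]: about to execute the instruction at [pc];
   [inl (true, pc)]: second half of a pop;
   [inr k]: start, query, yes, no, accept, reject.
   As the query state forgets where it came from, a query at [pc] marks tape [fidx pc]
   beforehand, and [resume] finds the return address by looking for the mark. *)
Definition mstate := ((bool * 'I_n) + 'I_6)%type.
Definition at_pc (pc : nat) : mstate := inl (false, inord pc).
Definition special (k : nat) : mstate := inr (inord k).

Definition reads := {ffun 'I_ntapes -> sym}.
Definition acts := {ffun 'I_ntapes -> (sym * move)}.

Definition touch (j0 : 'I_ntapes) (a : sym * move) (r : reads) : acts :=
  [ffun j => if j == j0 then a else (r j, MoveS)].
Definition keep (r : reads) : acts := [ffun j => (r j, MoveS)].

Definition resume (yes : bool) (r : reads) : mstate * acts :=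
  match [pick p | r (fidx p) == Some true] with
  | Some p => match onth P p with
    | Some (IQuery ly ln) =>
        (at_pc (if yes then ly else ln), touch (fidx p) (None, MoveS) r)
    | _ => (special 5, keep r)
    end
  | None => (special 5, keep r)
  end.

(** A pop takes two steps because the head rests on the blank after the top: it moves left, then
    reads and erases. At the left end the move is idle, so a blank read in the second half signals
    an empty stack. *)
Definition mdelta (q : mstate) (r : reads) : mstate * acts :=
  match q with
  | inl (false, pc) =>
    match onth P pc with
    | Some (IPush i b l) => (at_pc l, touch (tidx i) (Some b, MoveR) r)
    | Some (IPop i _ _ _) => (inl (true, pc), touch (tidx i) (r (tidx i), MoveL) r)
    | Some (IQuery _ _) => (special 1, touch (fidx pc) (Some true, MoveS) r)
    | Some (IHalt b) => (special (if b then 4 else 5), keep r)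
    | None => (special 5, keep r)
    end
  | inl (true, pc) =>
    match onth P pc with
    | Some (IPop i le l0 l1) =>
      match r (tidx i) with
      | None => (at_pc le, keep r)
      | Some b => (at_pc (if b then l1 else l0), touch (tidx i) (None, MoveS) r)
      end
    | _ => (special 5, keep r)
    end
  | inr k =>
    if k == inord 0 then
      match r ord0 with
      | Some b => (special 0, [ffun j => if j == ord0 then (Some b, MoveR)
                                 else if j == tidx sT then (Some b, MoveR)
                                 else (r j, MoveS)])
      | None => (at_pc entry, keep r)
      end
    else if k == inord 2 then resume true r
    else if k == inord 3 then resume false r
    else (special 5, keep r)
  end.

Definition machine : OTM :=
  {| nw := 4 + n; ns := #|{: mstate}|;
     q_start := enum_rank (special 0); q_query := enum_rank (special 1);
     q_yes := enum_rank (special 2); q_no := enum_rank (special 3);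
     q_acc := enum_rank (special 4); q_rej := enum_rank (special 5);
     delta := fun q r => let d := mdelta (enum_val q) r in (enum_rank d.1, d.2) |}.

Definition blank (s : seq sym) := all (pred1 None) s.
(** Cells left of the head are stored in reverse, so the top of the stack is next to the head and
    the tape spells the stack from bottom to top. This is why [exec] queries the reversed stack. *)
Definition holds (s : seq bool) (t : tape) := t.1 = map Some s /\ blank t.2.

Definition rep (st : stk) (ts : 'I_ntapes -> tape) :=
  (forall i : 'I_5, holds (peek st i) (ts (tidx i))) /\
  (forall p, blank (ts (fidx p)).2).

Definition mconf (q : mstate) (ts : 'I_ntapes -> tape) : config machine :=
  (enum_rank q, ts).

Definition apply_acts (a : acts) (ts : 'I_ntapes -> tape) : 'I_ntapes -> tape :=
  fun i => tape_move (a i).2 (tape_write (a i).1 (ts i)).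

Definition scan (ts : 'I_ntapes -> tape) : reads := [ffun i => tape_read (ts i)].

Lemma inord6 k : k < 6 -> (inord k : 'I_6) = k :> nat.
Proof. exact: inordK. Qed.

Lemma step_mconf X q ts :
  (forall k : 'I_6, q = inr k -> (k : nat) != 1 /\ k < 4) ->
  step X (mconf q ts) =
  mconf (mdelta q (scan ts)).1 (apply_acts (mdelta q (scan ts)).2 ts).
Proof.
move=> H; rewrite /step /halted /= !(inj_eq enum_rank_inj).
have E k : k < 6 -> ~~ ((k != 1) && (k < 4)) -> (q == special k) = false.
  move=> lk Hk; apply/eqP => Eq; move/negP: Hk; apply.
  by have [] := H _ Eq; rewrite inord6 // => -> ->.
by rewrite !E // /mconf /= enum_rankK.
Qed.

Lemma step_query X ts :
  step X (mconf (special 1) ts) =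
  mconf (special (if X (tape_word (ts (tidx sQ))) then 2 else 3)) ts.
Proof.
rewrite /step /halted /= !(inj_eq enum_rank_inj).
have E k : k < 6 -> k != 1 -> (special 1 == special k) = false.
  move=> lk Hk; apply/eqP => -[/(congr1 val)].
  by rewrite /= !inord6 // => E; rewrite -E in Hk.
rewrite (E 4) // (E 5) // eqxx /mconf /= /query_tape.
have -> : tidx sQ = @lift (nw machine).+2 ord0 ord0 by apply: val_inj.
by case: ifP.
Qed.

Lemma holds_keep s t : holds s t -> holds s (tape_write (tape_read t) t).
Proof.
by case=> E; case: t E => l [|a r] /= -> //= /andP[/eqP/= -> B]; split.
Qed.

Lemma blank_keep t : blank t.2 -> blank (tape_write (tape_read t) t).2.
Proof. by case: t => l [|a r] //=. Qed.

Lemma holds_read s t : holds s t -> tape_read t = None.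
Proof. by case: t => l [|a r] [_] //= /andP[/eqP]. Qed.

Lemma blank_read t : blank t.2 -> tape_read t = None.
Proof. by case: t => l [|a r] //= /andP[/eqP]. Qed.

Lemma holds_push s t b : holds s t -> holds (b :: s) (tape_move MoveR (tape_write (Some b) t)).
Proof. by case: t => l [|a r] [/= -> B]; split => //=; case/andP: B. Qed.

Lemma holds_word s t : holds s t -> tape_word t = rev s.
Proof.
case: t => l r [/= -> B]; rewrite /tape_word /= -map_rev.
elim: (rev s) => [|b u IH] /=; last by rewrite IH.
by case: r B => //= a r /andP[/eqP/= ->].
Qed.

Lemma rep_keep st ts : rep st ts -> rep st (apply_acts (keep (scan ts)) ts).
Proof.
move=> [H F]; split=> [i|p]; rewrite /apply_acts !ffunE /=; first exact: holds_keep.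
exact: blank_keep.
Qed.

Definition runs X (c c' : config machine) := exists t, iter t (step X) c = c'.

Lemma runs_trans X c1 c2 c3 : runs X c1 c2 -> runs X c2 c3 -> runs X c1 c3.
Proof. by move=> [t <-] [u <-]; exists (u + t); rewrite iterD. Qed.

Lemma runs1 X c c' : step X c = c' -> runs X c c'.
Proof. by exists 1. Qed.

Lemma onth_lt (T : Type) (s : seq T) j x : onth s j = Some x -> j < size s.
Proof. by elim: s j => [|y s IH] [|j] //= /IH. Qed.

Lemma at_pcK pc ins : onth P pc = Some ins -> ((inord pc : 'I_n) : nat) = pc.
Proof. by move=> E; have H := onth_lt E; rewrite inordK // /n ltnS ltnW. Qed.

Lemma sstep_runs X c c' ts : sstep P X c c' -> rep c.2 ts ->
  exists ts', rep c'.2 ts' /\ runs X (mconf (at_pc c.1) ts) (mconf (at_pc c'.1) ts').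
Proof.
case=> {c c'} [pc i b l st Ei|pc i le l0 l1 st Ei Ep|pc i le l0 l1 b r st Ei Ep|
  pc ly ln st Ei] /= [R F].
- eexists; split; last by apply: runs1; rewrite step_mconf //= (at_pcK Ei) Ei.
  split=> [j|p]; rewrite /apply_acts !ffunE /= !(tidx_eq, fidx_tidx).
    rewrite nth_set_nth /= (inj_eq val_inj); case: eqP => [->|_]; first exact: holds_push.
    exact: holds_keep.
  exact: blank_keep.
- have Hp : ((inord pc : 'I_n) : nat) = pc by apply: at_pcK Ei.
  set ts1 := apply_acts (touch (tidx i) (scan ts (tidx i), MoveL) (scan ts)) ts.
  have S1 : runs X (mconf (at_pc pc) ts) (mconf (inl (true, inord pc)) ts1).
    by apply: runs1; rewrite step_mconf //= Hp Ei.
  move: (R i) => [E B]; have Rd := holds_read (R i); rewrite Ep /= in E.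
  have D : mdelta (inl (true, inord pc)) (scan ts1) = (at_pc le, keep (scan ts1)).
    rewrite /= Hp Ei ffunE /ts1 /apply_acts !ffunE eqxx /= E /=.
    by rewrite /tape_read /= -/(tape_read _) Rd.
  exists (apply_acts (keep (scan ts1)) ts1); split; last first.
    by apply: runs_trans S1 _; apply: runs1; rewrite step_mconf // D.
  apply: rep_keep; rewrite /ts1.
  split=> [j|p]; rewrite /apply_acts !ffunE /= !(tidx_eq, fidx_tidx).
    case: eqP => [->|_] /=; last exact: holds_keep.
    rewrite Ep /tape_write /= E; split=> //=.
    by move: B; rewrite /tape_read; case: (ts _).2 => //= a l /andP[].
  exact: blank_keep.
- have Hp : ((inord pc : 'I_n) : nat) = pc by apply: at_pcK Ei.
  set ts1 := apply_acts (touch (tidx i) (scan ts (tidx i), MoveL) (scan ts)) ts.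
  have S1 : runs X (mconf (at_pc pc) ts) (mconf (inl (true, inord pc)) ts1).
    by apply: runs1; rewrite step_mconf //= Hp Ei.
  move: (R i) => [E B]; rewrite Ep /= in E.
  have D : mdelta (inl (true, inord pc)) (scan ts1) =
      (at_pc (if b then l1 else l0), touch (tidx i) (None, MoveS) (scan ts1)).
    by rewrite /= Hp Ei ffunE /ts1 /apply_acts !ffunE eqxx /= E /tape_read /=.
  exists (apply_acts (touch (tidx i) (None, MoveS) (scan ts1)) ts1); split; last first.
    by apply: runs_trans S1 _; apply: runs1; rewrite step_mconf // D.
  split=> [j|p]; rewrite /apply_acts !ffunE /= !(tidx_eq, fidx_tidx).
    rewrite nth_set_nth /= (inj_eq val_inj) /ts1 /apply_acts !ffunE tidx_eq.
    case: eqP => [->|_]; last by do 2 apply: holds_keep.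
    rewrite /tape_write /= E /=; split=> //=.
    by move: B; rewrite /tape_read; case: (ts _).2 => //= a l /andP[-> ->].
  by rewrite /ts1 /apply_acts !ffunE fidx_tidx; do 2 apply: blank_keep.
- have Hp : ((inord pc : 'I_n) : nat) = pc by apply: at_pcK Ei.
  have W := holds_word (R sQ).
  set ts1 := apply_acts (touch (fidx (inord pc)) (Some true, MoveS) (scan ts)) ts.
  have S1 : runs X (mconf (at_pc pc) ts) (mconf (special 1) ts1).
    by apply: runs1; rewrite step_mconf //= Hp Ei.
  have S2 : runs X (mconf (special 1) ts1)
     (mconf (special (if X (rev (peek st sQ)) then 2 else 3)) ts1).
    apply: runs1; rewrite step_query.
    have -> // : tape_word (ts1 (tidx sQ)) = rev (peek st sQ).
    apply: holds_word; rewrite /ts1 /apply_acts !ffunE tidx_fidx /=.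
    exact: holds_keep (R sQ).
  (* Only the tape of the querying instruction is marked, so [resume] finds the right return
     address. *)
  have Fl p : tape_read (ts1 (fidx p)) = if p == inord pc then Some true else None.
    rewrite /ts1 /apply_acts !ffunE fidx_eq; case: eqP => [->|_] //=.
    by rewrite /tape_read /=; move: (blank_read (F p)).
  eexists; split; last first.
    apply: runs_trans S1 _; apply: runs_trans S2 _; apply: runs1.
    rewrite step_mconf; last first.
      by move=> k [<-]; case: (X _); rewrite inord6.
    have Rs b : resume b (scan ts1) =
      (at_pc (if b then ly else ln), touch (fidx (inord pc)) (None, MoveS) (scan ts1)).
      rewrite /resume; case: pickP => [p|/(_ (inord pc))]; last by rewrite ffunE Fl !eqxx.
      by rewrite ffunE Fl; case: (p =P inord pc) => // -> _; rewrite Hp Ei.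
    have D b : mdelta (special (if b then 2 else 3)) (scan ts1) = resume b (scan ts1).
      by rewrite /mdelta /special -!(inj_eq val_inj) /=; case: b; rewrite !inord6.
    by rewrite D Rs /=.
  split=> [j|p]; rewrite /apply_acts !ffunE /= !(tidx_fidx, fidx_eq).
    apply: holds_keep; rewrite /ts1 /apply_acts !ffunE tidx_fidx /=.
    exact: holds_keep.
  case: eqP => [->|/eqP/negbTE E] /=; rewrite /ts1 /apply_acts !ffunE fidx_eq ?eqxx ?E /=.
    by move: (F (inord pc)); case: (ts _).2 => //= a l /andP[].
  by do 2 apply: blank_keep.
Qed.

Lemma star_runs X c c' : star (sstep P X) c c' -> forall ts, rep c.2 ts ->
  exists ts', rep c'.2 ts' /\ runs X (mconf (at_pc c.1) ts) (mconf (at_pc c'.1) ts').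
Proof.
elim=> {c c'} [c|c c1 c' S _ IH] ts R.
  by exists ts; split=> //; exists 0.
have [ts1 [R1 S1]] := sstep_runs S R.
by have [ts2 [R2 S2]] := IH _ R1; exists ts2; split=> //; apply: runs_trans S1 S2.
Qed.

(** Loop invariant of the loading phase: [y] is the part of the input already copied to [sT], last
    letter on top. *)
Lemma load_runs X y x ts :
  ts ord0 = (map Some (rev y), map Some x) ->
  rep [:: [::]; [::]; rev y] ts ->
  exists ts', rep [:: [::]; [::]; rev (y ++ x)] ts' /\
    runs X (mconf (special 0) ts) (mconf (at_pc entry) ts').
Proof.
have D r : mdelta (special 0) r = match r ord0 with
      | Some b => (special 0, [ffun j => if j == ord0 then (Some b, MoveR)
                                 else if j == tidx sT then (Some b, MoveR)
                                 else (r j, MoveS)])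
      | None => (at_pc entry, keep r)
      end by rewrite /mdelta /special eqxx.
have S ts1 : step X (mconf (special 0) ts1) = mconf (mdelta (special 0) (scan ts1)).1
   (apply_acts (mdelta (special 0) (scan ts1)).2 ts1).
  by apply: step_mconf => k [<-]; rewrite inord6.
elim: x y ts => [|b x IH] y ts E R.
  exists (apply_acts (keep (scan ts)) ts); split; first by rewrite cats0; apply: rep_keep.
  by apply: runs1; rewrite S D ffunE /tape_read E.
set ts1 := (apply_acts (mdelta (special 0) (scan ts)).2 ts).
have A : scan ts ord0 = Some b by rewrite ffunE /tape_read E.
have [] := IH (rcons y b) ts1.
- by rewrite /ts1 D A /apply_acts !ffunE /= E /= rev_rcons.
- case: R => R F; rewrite /ts1 D A; split=> [j|p]; rewrite /apply_acts !ffunE /=.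
    rewrite tidx_eq rev_rcons; case: (j =P sT) => [->|N].
      by rewrite /=; apply: holds_push; apply: (R sT).
    have -> : peek [:: [::]; [::]; b :: rev y] j = peek [:: [::]; [::]; rev y] j.
      by case: j N => -[|[|[|j]]] //= lj []; apply: val_inj.
    by apply: holds_keep; apply: R.
  by rewrite ?fidx_tidx; apply: blank_keep.
move=> ts2 [R2 S2]; rewrite cat_rcons in R2.
by exists ts2; split=> //; apply: runs_trans S2; apply: runs1; rewrite S D A /ts1 D A.
Qed.

Lemma machine_outputs X x st b pc :
  star (sstep P X) (entry, [:: [::]; [::]; rev x]) (pc, st) ->
  onth P pc = Some (IHalt b) -> exists t, outputs_within machine X x t b.
Proof.
move=> St Hpc.
have [|| ts1 [R1 [t1 E1]]] := @load_runs X [::] x (init machine x).2.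
- by rewrite /init /=.
- split=> [i|p] //=.
  by case: i => -[|[|[|i]]] //= li; rewrite nth_nil.
have [ts2 [_ [t2 E2]]] := star_runs St R1.
exists (1 + (t2 + t1)); rewrite /outputs_within /run !iterD.
have -> : init machine x = mconf (special 0) (init machine x).2 by [].
rewrite E1 E2 /= step_mconf //= (at_pcK Hpc) Hpc /=.
rewrite /halted /= !(inj_eq enum_rank_inj).
by case: b {Hpc}; rewrite ?eqxx ?orbT //; split=> //; apply/eqP => -[/(congr1 val)];
  rewrite /= !inord6.
Qed.

End Assemble.

Theorem compile (p : cmd) : exists M : OTM, forall X x b r st,
  exec X p [:: [::]; [::]; rev x] st -> peek st sS = b :: r ->
  exists t, outputs_within M X x t b.
Proof.
(* The code starts at address 3 and exits to address 2, where the answer is popped from [sS] and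
   selects the halting instruction at address 0 or 1. *)
pose q := asm p 2 3.
pose P := [:: IHalt false, IHalt true, IPop sS 0 0 1 & q.2].
exists (@machine P q.1) => X x b r st E T.
have H : code_at P 3 q.2 by [].
have S := asm_correct E H.
apply: (@machine_outputs P q.1 X x (poke st sS r) b (if b then 1 else 0)).
  apply: star_trans S _; apply: starS (star0 _ _).
  by apply: SPop T.
by case: b T.
Qed.

(** * Binary trees on a stack *)

Inductive tree := Leaf | Node of tree & tree.

(** The preorder code is self-delimiting: a tree on top of a stack can be taken off without
    separators. *)
Fixpoint code (t : tree) : word :=
  match t with Leaf => [:: false] | Node a b => true :: code a ++ code b end.

Section Gadgets.
Variable X : lang.

Lemma exec_push i b st st' : poke st i (b :: peek st i) = st' -> exec X (Push i b) st st'.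
Proof. by move<-; apply: EPush. Qed.

Lemma exec_case i ce c0 c1 b r st st1 st' :
  peek st i = b :: r -> poke st i r = st1 -> exec X (if b then c1 else c0) st1 st' ->
  exec X (Case i ce c0 c1) st st'.
Proof. by move=> E <-; apply: ECase. Qed.

Lemma exec_loop i z c0 c1 b r st st0 st1 st2 :
  peek st i = b :: r -> b || z -> poke st i r = st0 ->
  exec X (if b then c1 else c0) st0 st1 ->
  exec X (Loop i z c0 c1) st1 st2 -> exec X (Loop i z c0 c1) st st2.
Proof. by move=> E bz <-; apply: ELoopGo. Qed.

Definition move_body (i : 'I_5) : cmd :=
  Case sS Skip (Push i false) (Seq (Push i true) (Seq (Push sC true) (Push sC true))).
(* [sC] counts the trees that remain to be read. *)
Definition move_tree (i : 'I_5) : cmd :=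
  Seq (Push sC true) (Loop sC true Skip (move_body i)).

Definition stacks q s t u c : stk := [:: q; s; t; u; c].

(** The rest [c] of the counter is arbitrary so that the induction applies to both subtrees in turn:
    reading a node replaces one awaited tree by two. *)
Lemma move_loopT q s t u c x st' :
  exec X (Loop sC true Skip (move_body sT)) (stacks q s (catrev (code x) t) u c) st' ->
  exec X (Loop sC true Skip (move_body sT)) (stacks q (code x ++ s) t u (true :: c)) st'.
Proof.
elim: x s t c st' => [|a IHa b IHb] s t c st' /= H.
  apply: exec_loop (H) => //; apply: exec_case => //=.
  by apply: exec_push.
rewrite catrev_catl in H.
have {}H := IHa _ _ _ _ (IHb _ _ _ _ H).
rewrite -catA.
apply: exec_loop (H) => //; apply: exec_case => //=.
by apply: ESeq; [|apply: ESeq]; apply: exec_push.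
Qed.

Lemma exec_move_treeT q s t u x :
  exec X (move_tree sT) (stacks q (code x ++ s) t u [::])
                        (stacks q s (catrev (code x) t) u [::]).
Proof.
apply: ESeq; first exact: exec_push.
by apply: move_loopT; apply: ELoopE.
Qed.

Lemma move_loopU q s t u c x st' :
  exec X (Loop sC true Skip (move_body sU)) (stacks q s t (catrev (code x) u) c) st' ->
  exec X (Loop sC true Skip (move_body sU)) (stacks q (code x ++ s) t u (true :: c)) st'.
Proof.
elim: x s u c st' => [|a IHa b IHb] s u c st' /= H.
  apply: exec_loop (H) => //; apply: exec_case => //=.
  by apply: exec_push.
rewrite catrev_catl in H.
have {}H := IHa _ _ _ _ (IHb _ _ _ _ H).
rewrite -catA.
apply: exec_loop (H) => //; apply: exec_case => //=.
by apply: ESeq; [|apply: ESeq]; apply: exec_push.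
Qed.

Lemma exec_move_treeU q s t u x :
  exec X (move_tree sU) (stacks q (code x ++ s) t u [::])
                        (stacks q s t (catrev (code x) u) [::]).
Proof.
apply: ESeq; first exact: exec_push.
by apply: move_loopU; apply: ELoopE.
Qed.

Definition drain (i j : 'I_5) : cmd := Loop i true (Push j false) (Push j true).

Lemma exec_drainTS q s t u c :
  exec X (drain sT sS) (stacks q s t u c) (stacks q (catrev t s) [::] u c).
Proof.
elim: t s => [|b t IH] s; first exact: ELoopE.
apply: exec_loop (IH (b :: s)) => //; first by rewrite orbT.
by case: b; apply: exec_push.
Qed.

Lemma exec_drainUS q s t u c :
  exec X (drain sU sS) (stacks q s t u c) (stacks q (catrev u s) t [::] c).
Proof.
elim: u s => [|b u IH] s; first exact: ELoopE.
apply: exec_loop (IH (b :: s)) => //; first by rewrite orbT.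
by case: b; apply: exec_push.
Qed.

Lemma exec_drainUT q s t u c :
  exec X (drain sU sT) (stacks q s t u c) (stacks q s (catrev u t) [::] c).
Proof.
elim: u t => [|b u IH] t; first exact: ELoopE.
apply: exec_loop (IH (b :: t)) => //; first by rewrite orbT.
by case: b; apply: exec_push.
Qed.

Definition drainTSU : cmd :=
  Loop sT true (Seq (Push sS false) (Push sU false)) (Seq (Push sS true) (Push sU true)).

Lemma exec_drainTSU q s t u c :
  exec X drainTSU (stacks q s t u c) (stacks q (catrev t s) [::] (catrev t u) c).
Proof.
elim: t s u => [|b t IH] s u; first exact: ELoopE.
apply: exec_loop (IH (b :: s) (b :: u)) => //; first by rewrite orbT.
by case: b; apply: ESeq; apply: exec_push.
Qed.

Definition erase (i : 'I_5) : cmd := Loop i true Skip Skip.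

Lemma exec_eraseT q s t u c :
  exec X (erase sT) (stacks q s t u c) (stacks q s [::] u c).
Proof.
elim: t => [|b t IH]; first exact: ELoopE.
by apply: exec_loop (IH) => //; [rewrite orbT | case: b; apply: ESkip].
Qed.

Lemma exec_eraseQ q s t u c :
  exec X (erase sQ) (stacks q s t u c) (stacks [::] s t u c).
Proof.
elim: q => [|b q IH]; first exact: ELoopE.
by apply: exec_loop (IH) => //; [rewrite orbT | case: b; apply: ESkip].
Qed.

Definition onS (s : seq bool) : stk := stacks [::] s [::] [::] [::].

Definition dup : cmd :=
  Seq (move_tree sT) (Seq drainTSU (Seq (drain sU sT) (drain sT sS))).

Lemma catrevK (T : Type) (s r : seq T) : catrev (catrev s [::]) r = s ++ r.
Proof. by rewrite !catrevE cats0 revK. Qed.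

Lemma exec_dup x s : exec X dup (onS (code x ++ s)) (onS (code x ++ code x ++ s)).
Proof.
apply: ESeq (exec_move_treeT _ _ _ _ _) _.
apply: ESeq (exec_drainTSU _ _ _ _ _) _.
rewrite catrevK [catrev (catrev _ _) [::]]catrevK cats0.
apply: ESeq (exec_drainUT _ _ _ _ _) _.
by rewrite -[X in onS X]catrevK; apply: exec_drainTS.
Qed.

Definition swap : cmd :=
  Seq (move_tree sT) (Seq (move_tree sU) (Seq (drain sT sS) (drain sU sS))).

Lemma exec_swap x y s :
  exec X swap (onS (code x ++ code y ++ s)) (onS (code y ++ code x ++ s)).
Proof.
apply: ESeq (exec_move_treeT _ _ _ _ _) _.
apply: ESeq (exec_move_treeU _ _ _ _ _) _.
apply: ESeq (exec_drainTS _ _ _ _ _) _.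
by rewrite catrevK -[X in onS X]catrevK; apply: exec_drainUS.
Qed.

Definition drop_tree : cmd := Seq (move_tree sT) (erase sT).

Lemma exec_drop x s : exec X drop_tree (onS (code x ++ s)) (onS s).
Proof. by apply: ESeq (exec_move_treeT _ _ _ _ _) _; apply: exec_eraseT. Qed.

Fixpoint push_word (w : word) : cmd :=
  if w is b :: w' then Seq (push_word w') (Push sS b) else Skip.

Lemma exec_push_word w q s t u c :
  exec X (push_word w) (stacks q s t u c) (stacks q (w ++ s) t u c).
Proof.
elim: w => [|b w IH] /=; first exact: ESkip.
by apply: ESeq IH _; apply: exec_push.
Qed.

Definition pop (c : cmd) : cmd := Case sS Skip c c.

Lemma exec_pop c b s st : exec X c (onS s) st -> exec X (pop c) (onS (b :: s)) st.
Proof. by move=> H; apply: exec_case => //; rewrite if_same. Qed.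

End Gadgets.

(** * Functions computed by bit-stack programs *)

Class Coded (A : Type) := { enc : A -> tree; dec : tree -> A; encK : cancel enc dec }.

#[export] Instance tree_coded : Coded tree := @Build_Coded tree id id (fun=> erefl).

Definition enc_bool (b : bool) := if b then Node Leaf Leaf else Leaf.
Definition dec_bool t := if t is Node _ _ then true else false.
Lemma enc_boolK : cancel enc_bool dec_bool. Proof. by case. Qed.
#[export] Instance bool_coded : Coded bool := Build_Coded enc_boolK.

Fixpoint enc_nat n := if n is m.+1 then Node Leaf (enc_nat m) else Leaf.
Fixpoint spine t := if t is Node a b then a :: spine b else [::].
Definition dec_nat t := size (spine t).
Lemma enc_natK : cancel enc_nat dec_nat.
Proof. by move=> n; rewrite /dec_nat; elim: n => //= n ->. Qed.
#[export] Instance nat_coded : Coded nat := Build_Coded enc_natK.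

Section CodedConstructors.
Context {A B : Type} {CA : Coded A} {CB : Coded B}.

Definition enc_prod (p : A * B) := Node (enc p.1) (enc p.2).
Definition dec_prod t : A * B :=
  if t is Node a b then (dec a, dec b) else (dec Leaf, dec Leaf).
Lemma enc_prodK : cancel enc_prod dec_prod.
Proof. by move=> [a b]; rewrite /= !encK. Qed.
#[export] Instance prod_coded : Coded (A * B) := Build_Coded enc_prodK.

Definition enc_option (o : option A) := if o is Some a then Node (enc a) Leaf else Leaf.
Definition dec_option t : option A := if t is Node a _ then Some (dec a) else None.
Lemma enc_optionK : cancel enc_option dec_option.
Proof. by move=> [a|] //=; rewrite encK. Qed.
#[export] Instance option_coded : Coded (option A) := Build_Coded enc_optionK.

Definition enc_seq : seq A -> tree := foldr (fun a t => Node (enc a) t) Leaf.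
Definition dec_seq t : seq A := map dec (spine t).
Lemma enc_seqK : cancel enc_seq dec_seq.
Proof. by rewrite /dec_seq => s; elim: s => //= a s ->; rewrite encK. Qed.
#[export] Instance seq_coded : Coded (seq A) := Build_Coded enc_seqK.

End CodedConstructors.

(** The program comes before the index, which makes computations uniform in the oracle. The rest [s]
    of the stack is preserved, which lets programs be composed. *)
Variant Comp (I : Type) (X : I -> lang) (A B : Type) {CA : Coded A} {CB : Coded B}
    (f : I -> A -> B) : Prop :=
  Computed p of forall i a s,
    exec (X i) p (onS (code (enc a) ++ s)) (onS (code (enc (f i a)) ++ s)).

Section Closure.
Variables (I : Type) (X : I -> lang).
Notation C := (Comp X).

Section Basic.
Context {A B D U V : Type} {CA : Coded A} {CB : Coded B} {CD : Coded D}
  {CU : Coded U} {CV : Coded V}.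

Lemma Comp_ext (f g : I -> A -> B) : C f -> (forall i a, g i a = f i a) -> C g.
Proof. by move=> [p Hp] E; exists p => i a s; rewrite E. Qed.

(** Constructors come for free where encodings coincide: a cons cell is a pair, a successor or a
    [Some] is a pair with a leaf. *)
Lemma Comp_cast (f : I -> A -> B) (g : I -> A -> D) :
  C f -> (forall i a, enc (g i a) = enc (f i a)) -> C g.
Proof. by move=> [p Hp] E; exists p => i a s; rewrite E. Qed.

Lemma Comp_id : C (fun _ (a : A) => a).
Proof. by exists Skip => i a s; apply: ESkip. Qed.

Lemma Comp_const (b : B) : C (fun _ (_ : A) => b).
Proof.
exists (Seq drop_tree (push_word (code (enc b)))) => i a s.
apply: ESeq (exec_drop _ _ _) _; exact: exec_push_word.
Qed.

Lemma Comp_app (g : I -> B -> D) (f : I -> A -> B) : C g -> C f -> C (fun i a => g i (f i a)).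
Proof.
by move=> [q Hq] [p Hp]; exists (Seq p q) => i a s; apply: ESeq (Hp _ _ _) (Hq _ _ _).
Qed.

Lemma Comp_pair (f : I -> A -> U) (g : I -> A -> V) :
  C f -> C g -> C (fun i a => (f i a, g i a)).
Proof.
move=> [p Hp] [q Hq].
exists (Seq dup (Seq p (Seq swap (Seq q (Seq swap (Push sS true)))))) => i a s.
apply: ESeq (exec_dup _ _ _) _; apply: ESeq (Hp _ _ _) _.
apply: ESeq (exec_swap _ _ _ _) _; apply: ESeq (Hq _ _ _) _.
apply: ESeq (exec_swap _ _ _ _) _.
by apply: exec_push; rewrite /= -catA.
Qed.

Lemma Comp_fst (f : I -> A -> U * V) : C f -> C (fun i a => (f i a).1).
Proof.
move=> [p Hp]; exists (Seq p (Seq (pop Skip) (Seq swap drop_tree))) => i a s.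
apply: ESeq (Hp _ _ _) _; case: (f i a) => u v /=.
apply: ESeq; first by apply: exec_pop; apply: ESkip.
by rewrite -catA; apply: ESeq (exec_swap _ _ _ _) _; apply: exec_drop.
Qed.

Lemma Comp_snd (f : I -> A -> U * V) : C f -> C (fun i a => (f i a).2).
Proof.
move=> [p Hp]; exists (Seq p (Seq (pop Skip) drop_tree)) => i a s.
apply: ESeq (Hp _ _ _) _; case: (f i a) => u v /=.
apply: ESeq; first by apply: exec_pop; apply: ESkip.
by rewrite -catA; apply: exec_drop.
Qed.

(* Every case analysis on encoded data splits off the two subtrees of a node. *)
Lemma Comp_split (t : I -> A -> D) (o : I -> A -> option (U * V)) (z : I -> A -> B)
    (g : I -> A * (U * V) -> B) :
  C t -> (forall i a, enc (t i a) = oapp enc Leaf (o i a)) -> C z -> C g ->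
  C (fun i a => if o i a is Some y then g i (a, y) else z i a).
Proof.
move=> [p Hp] E [pz Hz] [pg Hg].
exists (Seq dup (Seq p (Case sS Skip pz
   (Seq (Push sS true) (Seq swap (Seq (Push sS true) pg)))))) => i a s.
apply: ESeq (exec_dup _ _ _) _; apply: ESeq (Hp _ _ _) _; rewrite E.
case: (o i a) => [[u v]|] /=; last by apply: exec_case => //=; apply: Hz.
apply: exec_case => //=; rewrite -catA.
apply: ESeq; first exact: exec_push.
have -> : true :: code (enc u) ++ code (enc v) ++ code (enc a) ++ s =
          code (enc (u, v)) ++ code (enc a) ++ s by rewrite /= -catA.
apply: ESeq (exec_swap _ _ _ _) _.
apply: ESeq; first exact: exec_push.
by have := Hg i (a, (u, v)) s; rewrite /= -!catA cat_cons -!catA.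
Qed.

End Basic.

Section Cases.
Context {A B Y : Type} {CA : Coded A} {CB : Coded B} {CY : Coded Y}.

Lemma Comp_if (b : I -> A -> bool) (f g : I -> A -> B) :
  C b -> C f -> C g -> C (fun i a => if b i a then f i a else g i a).
Proof.
move=> Hb Hf Hg.
have Hf' : C (fun i (p : A * (tree * tree)) => f i p.1) by apply: Comp_app Hf (Comp_fst Comp_id).
have := Comp_split (o := fun i a => if b i a then Some (Leaf, Leaf) else None) Hb _ Hg Hf'.
by move=> /(_ _)/Comp_ext; apply=> [i a|i a]; case: (b i a).
Qed.

Lemma Comp_lcase (l : I -> A -> seq Y) (z : I -> A -> B) (g : I -> A -> Y -> seq Y -> B) :
  C l -> C z -> C (fun i (p : A * (Y * seq Y)) => g i p.1 p.2.1 p.2.2) ->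
  C (fun i a => match l i a with [::] => z i a | y :: l' => g i a y l' end).
Proof.
move=> Hl Hz Hg.
have := Comp_split (o := fun i a => if l i a is y :: l' then Some (y, l') else None) Hl _ Hz Hg.
by move=> /(_ _)/Comp_ext; apply=> [i a|i a]; case: (l i a).
Qed.

Lemma Comp_ncase (n : I -> A -> nat) (z : I -> A -> B) (g : I -> A -> nat -> B) :
  C n -> C z -> C (fun i (p : A * nat) => g i p.1 p.2) ->
  C (fun i a => match n i a with 0 => z i a | m.+1 => g i a m end).
Proof.
move=> Hn Hz Hg.
have Hg' : C (fun i (p : A * (tree * nat)) => g i p.1 p.2.2).
  exact: Comp_app Hg (Comp_pair (Comp_fst Comp_id) (Comp_snd (Comp_snd Comp_id))).
have := Comp_split (o := fun i a => if n i a is m.+1 then Some (Leaf, m) else None) Hn _ Hz Hg'.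
by move=> /(_ _)/Comp_ext; apply=> [i a|i a]; case: (n i a).
Qed.

Lemma Comp_ocase (o : I -> A -> option Y) (z : I -> A -> B) (g : I -> A -> Y -> B) :
  C o -> C z -> C (fun i (p : A * Y) => g i p.1 p.2) ->
  C (fun i a => match o i a with None => z i a | Some y => g i a y end).
Proof.
move=> Ho Hz Hg.
have Hg' : C (fun i (p : A * (Y * tree)) => g i p.1 p.2.1).
  exact: Comp_app Hg (Comp_pair (Comp_fst Comp_id) (Comp_fst (Comp_snd Comp_id))).
have := Comp_split (o := fun i a => if o i a is Some y then Some (y, Leaf) else None) Ho _ Hz Hg'.
by move=> /(_ _)/Comp_ext; apply=> [i a|i a]; case: (o i a).
Qed.

Lemma Comp_tcase (t : I -> A -> tree) (z : I -> A -> B) (g : I -> A -> tree -> tree -> B) :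
  C t -> C z -> C (fun i (p : A * (tree * tree)) => g i p.1 p.2.1 p.2.2) ->
  C (fun i a => match t i a with Leaf => z i a | Node u v => g i a u v end).
Proof.
move=> Ht Hz Hg.
have := Comp_split (o := fun i a => if t i a is Node u v then Some (u, v) else None) Ht _ Hz Hg.
by move=> /(_ _)/Comp_ext; apply=> [i a|i a]; case: (t i a).
Qed.

Lemma Comp_cons (f : I -> A -> Y) (g : I -> A -> seq Y) :
  C f -> C g -> C (fun i a => f i a :: g i a).
Proof. by move=> Hf Hg; apply: (Comp_cast (Comp_pair Hf Hg)). Qed.

Lemma Comp_some (f : I -> A -> Y) : C f -> C (fun i a => Some (f i a)).
Proof. by move=> Hf; apply: (Comp_cast (Comp_pair Hf (Comp_const Leaf))). Qed.

Lemma Comp_succ (f : I -> A -> nat) : C f -> C (fun i a => (f i a).+1).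
Proof. by move=> Hf; apply: (Comp_cast (Comp_pair (Comp_const Leaf) Hf)). Qed.

Lemma Comp_node (f g : I -> A -> tree) : C f -> C g -> C (fun i a => Node (f i a) (g i a)).
Proof. by move=> Hf Hg; apply: (Comp_cast (Comp_pair Hf Hg)). Qed.

(** The count [N] is not computed beforehand: the loop discovers it by testing. Folds, iteration and
    unbounded search all reduce to this lemma. *)
Lemma Comp_while (test : I -> Y -> bool) (step : I -> Y -> Y) (x0 : I -> A -> Y)
    (N : I -> A -> nat) :
  C test -> C step -> C x0 ->
  (forall i a k, k < N i a -> test i (iter k (step i) (x0 i a))) ->
  (forall i a, ~~ test i (iter (N i a) (step i) (x0 i a))) ->
  C (fun i a => iter (N i a) (step i) (x0 i a)).
Proof.
move=> [pt Ht] [ps Hs] [p0 H0] lt eqN.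
pose round := Seq dup pt.
pose body := Seq (pop (pop Skip)) (Seq ps round).
exists (Seq p0 (Seq round (Loop sS false Skip body))) => i a s.
apply: ESeq (H0 _ _ _) _.
pose flagged (y : Y) : stk := onS (code (enc_bool (test i y)) ++ code (@enc _ CY y) ++ s).
pose done : stk := onS (code (@enc _ CY (iter (N i a) (step i) (x0 i a))) ++ s).
have R (y : Y) : exec (X i) round (onS (code (@enc _ CY y) ++ s)) (flagged y).
  exact: ESeq (exec_dup _ _ _) (Ht _ _ _).
apply: ESeq (R _) _.
suff : forall m k, k + m = N i a ->
   exec (X i) (Loop sS false Skip body) (flagged (iter k (step i) (x0 i a))) done.
  by move=> /(_ (N i a) 0 erefl).
elim=> [|m IH] k E.
  rewrite addn0 in E; rewrite /flagged E (negbTE (eqN i a)) /=.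
  by apply: ELoopStop => //; apply: ESkip.
rewrite /flagged lt /=; last by rewrite -E -addSnnS leq_addr.
have {}IH := IH k.+1; rewrite addSnnS in IH; have {}IH := IH E.
apply: exec_loop (IH) => //=.
apply: ESeq; first by do 2 apply: exec_pop; apply: ESkip.
exact: ESeq (Hs _ _ _) (R _).
Qed.

End Cases.

Section Query.
Context {A : Type} {CA : Coded A}.

Definition load_query : cmd :=
  Loop sS false Skip (Case sS Skip (Push sQ false) (pop (pop (Push sQ true)))).

Lemma exec_load_query L q (w : word) s :
  exec L load_query (stacks q (code (enc w) ++ s) [::] [::] [::])
    (stacks (catrev w q) s [::] [::] [::]).
Proof.
elim: w q => [|b w IH] q /=; first by apply: ELoopStop => //; apply: ESkip.
rewrite -catA; apply: exec_loop (IH (b :: q)) => //=.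
case: b; apply: exec_case => //=; last exact: exec_push.
apply: exec_case => //=; apply: exec_case => //=; exact: exec_push.
Qed.

Lemma Comp_query (f : I -> A -> word) : C f -> C (fun i a => X i (f i a)).
Proof.
move=> [p Hp].
pose push b := Seq (erase sQ) (push_word (code (enc_bool b))).
exists (Seq p (Seq load_query (Query (push true) (push false)))) => i a s.
apply: ESeq (Hp _ _ _) _; apply: ESeq (exec_load_query _ _ _ _) _.
apply: EQuery; rewrite /= catrevE cats0 revK.
by case: (X i _); apply: ESeq (exec_eraseQ _ _ _ _ _ _) _; apply: exec_push_word.
Qed.

End Query.

Definition unload : cmd :=
  Loop sT true (push_word [:: true; false]) (push_word [:: true; true; false; false]).

Lemma exec_unload L (x w : word) :
  exec L unload (stacks [::] (code (enc w)) (rev x) [::] [::]) (onS (code (enc (x ++ w)))).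
Proof.
elim/last_ind: x w => [|x b IH] w; first by apply: ELoopE.
rewrite rev_rcons cat_rcons.
apply: exec_loop (IH (b :: w)) => //; first by rewrite orbT.
case: b; exact: exec_push_word.
Qed.

(* The initial push and pop on [sC] allocates all five stacks. *)
Definition load_input : cmd :=
  Seq (Push sC true) (Seq (Case sC Skip Skip Skip) (Seq (Push sS false) unload)).

Lemma exec_load_input L (x : word) :
  exec L load_input [:: [::]; [::]; rev x] (onS (code (enc x))).
Proof.
apply: ESeq; first exact: exec_push.
apply: ESeq; first by apply: exec_case => //; apply: ESkip.
apply: ESeq; first exact: exec_push.
by have := exec_unload L x [::]; rewrite cats0.
Qed.

Theorem Comp_decides (f : I -> word -> bool) : C f -> exists M, forall i, decides M (X i) (f i).
Proof.
move=> [p Hp]; have [M HM] := compile (Seq load_input p).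
exists M => i x.
have := Hp i x [::]; rewrite !cats0 => E.
have {}E := ESeq (exec_load_input _ _) E.
by case E1 : (f i x) E => E; apply: HM E _.
Qed.

End Closure.

Definition Pure (A B : Type) {CA : Coded A} {CB : Coded B} (f : A -> B) :=
  forall I (X : I -> lang), Comp X (fun _ => f).

(** * Closure properties *)

(* Hooks, redefined below as soon as the lemmas that they apply are proved. *)
Ltac comp_ext := fail.
Ltac comp_hyp := fail.
Ltac comp_eq := fail.
Ltac comp_user := fail.
Ltac comp1 := first
  [ apply: Comp_const | apply: Comp_id | assumption | comp_hyp
  | apply: Comp_fst | apply: Comp_snd | apply: Comp_pair | apply: Comp_cons | apply: Comp_succ
  | apply: Comp_some | apply: Comp_node | apply: Comp_if
  | apply: Comp_lcase | apply: Comp_ncase | apply: Comp_ocase | apply: Comp_tcase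
  | comp_ext | comp_eq | comp_user ].
Ltac comp_auto := repeat comp1.

Section Application.
Variables (I : Type) (X : I -> lang).
Notation C := (Comp X).
Context {A B D Y Z : Type} {CA : Coded A} {CB : Coded B} {CD : Coded D}
  {CY : Coded Y} {CZ : Coded Z}.

Lemma Comp_comp2 (g : I -> B -> D -> Y) (f1 : I -> A -> B) (f2 : I -> A -> D) :
  C (fun i p => g i p.1 p.2) -> C f1 -> C f2 -> C (fun i a => g i (f1 i a) (f2 i a)).
Proof. by move=> Hg H1 H2; apply: (Comp_app Hg (Comp_pair H1 H2)). Qed.

Lemma Comp_comp3 (g : I -> B -> D -> Y -> Z) (f1 : I -> A -> B) (f2 : I -> A -> D)
    (f3 : I -> A -> Y) :
  C (fun i p => g i p.1.1 p.1.2 p.2) -> C f1 -> C f2 -> C f3 ->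
  C (fun i a => g i (f1 i a) (f2 i a) (f3 i a)).
Proof. by move=> Hg H1 H2 H3; apply: (Comp_app Hg (Comp_pair (Comp_pair H1 H2) H3)). Qed.

Lemma Comp_pure (g : B -> D) (f : I -> A -> B) : Pure g -> C f -> C (fun i a => g (f i a)).
Proof. by move=> /(_ I X); apply: Comp_app. Qed.

Lemma Comp_pure2 (g : B -> D -> Y) (f1 : I -> A -> B) (f2 : I -> A -> D) :
  Pure (fun p => g p.1 p.2) -> C f1 -> C f2 -> C (fun i a => g (f1 i a) (f2 i a)).
Proof. by move=> /(_ I X) Hg H1 H2; apply: (Comp_app Hg (Comp_pair H1 H2)). Qed.

End Application.

Ltac comp_hyp ::= match goal with
  | H : Pure ?g |- _ => apply: (Comp_pure H)
  | H : Pure (fun p => ?g p.1 p.2) |- _ => apply: (Comp_pure2 (g := g) H)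
  | H : Comp _ (fun i p => ?g i p.1.1 p.1.2 p.2) |- _ => apply: (Comp_comp3 (g := g) H)
  | H : Comp _ (fun i p => ?g i p.1 p.2) |- _ => apply: (Comp_comp2 (g := g) H)
  | H : Comp _ ?g |- _ => apply: (Comp_app H)
  end.

Section Fold.
Variables (I : Type) (X : I -> lang).
Notation C := (Comp X).
Context {A B Y : Type} {CA : Coded A} {CB : Coded B} {CY : Coded Y}.

Lemma Comp_foldl (g : I -> A -> B -> Y -> B) (z : I -> A -> B) (l : I -> A -> seq Y) :
  C (fun i p => g i p.1.1 p.1.2 p.2) -> C z -> C l ->
  C (fun i a => foldl (g i a) (z i a) (l i a)).
Proof.
move=> Hg Hz Hl.
pose step i (p : A * (seq Y * B)) :=
  match p.2.1 with [::] => p | y :: l' => (p.1, (l', g i p.1 p.2.2 y)) end.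
pose test (i : I) (p : A * (seq Y * B)) := match p.2.1 with [::] => false | _ :: _ => true end.
pose x0 i a := (a, (l i a, z i a)).
have It i a k : iter k (step i) (x0 i a) =
    (a, (drop k (l i a), foldl (g i a) (z i a) (take k (l i a)))).
  elim: k => [|k IH]; first by rewrite /= drop0 take0.
  rewrite iterS IH /step /=.
  case E: (drop k (l i a)) => [|y s].
    have le: size (l i a) <= k by rewrite leqNgt -subn_gt0 -size_drop E.
    by rewrite drop_oversize ?take_oversize // (leq_trans le).
  have lt: k < size (l i a) by rewrite -subn_gt0 -size_drop E.
  rewrite (take_nth y lt) foldl_rcons -addn1 addnC -drop_drop E drop1 /=.
  by have := nth_drop k y (l i a) 0; rewrite E addn0 /= => <-.
have W : C (fun i a => iter (size (l i a)) (step i) (x0 i a)).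
  apply: (Comp_while (test := test)).
  - by rewrite /test; comp_auto.
  - by rewrite /step; comp_auto.
  - by rewrite /x0; comp_auto.
  - move=> i a k lt; rewrite It /test /=.
    by case E: drop (size_drop k (l i a)) lt => //= /eqP; rewrite eq_sym subn_eq0 ltnNge => ->.
  - by move=> i a; rewrite It /test /= drop_size.
by apply: Comp_ext (Comp_snd (Comp_snd W)) _ => i a; rewrite It /= take_size.
Qed.

End Fold.

Section FoldVariants.
Variables (I : Type) (X : I -> lang).
Notation C := (Comp X).
Context {A B D Y Z : Type} {CA : Coded A} {CB : Coded B} {CD : Coded D}
  {CY : Coded Y} {CZ : Coded Z}.

Lemma Comp_rev (l : I -> A -> seq Y) : C l -> C (fun i a => rev (l i a)).
Proof.
move=> Hl; apply: (@Comp_ext _ _ _ _ _ _ (fun i a => foldl (fun s y => y :: s) [::] (l i a))).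
  by apply: Comp_foldl => //; comp_auto.
by move=> i a; rewrite /rev -[RHS]/(foldl _ _ _); elim: (l i a) [::] => //= y s IH r.
Qed.

Lemma Comp_foldr (g : I -> A -> Y -> B -> B) (z : I -> A -> B) (l : I -> A -> seq Y) :
  C (fun i p => g i p.1.1 p.1.2 p.2) -> C z -> C l ->
  C (fun i a => foldr (g i a) (z i a) (l i a)).
Proof.
move=> Hg Hz Hl.
apply: (@Comp_ext _ _ _ _ _ _ (fun i a => foldl (fun b y => g i a y b) (z i a) (rev (l i a)))).
  apply: Comp_foldl => //; last exact: Comp_rev.
  by comp_auto.
by move=> i a; rewrite foldl_rev.
Qed.

Lemma Comp_iter (n : I -> A -> nat) (g : I -> A -> B -> B) (z : I -> A -> B) :
  C n -> C (fun i p => g i p.1 p.2) -> C z -> C (fun i a => iter (n i a) (g i a) (z i a)).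
Proof.
move=> Hn Hg Hz.
have Hs : C (fun i a => nseq (n i a) Leaf).
  by apply: (Comp_cast Hn) => i a; rewrite /=; elim: (n i a) => //= m ->.
apply: (@Comp_ext _ _ _ _ _ _ (fun i a => foldl (fun b _ => g i a b) (z i a) (nseq (n i a) Leaf))).
  apply: Comp_foldl => //.
  by comp_auto.
move=> i a; elim: (n i a) (z i a) => //= m IH b; by rewrite -IH -iterSr.
Qed.

End FoldVariants.

Section ListMaps.
Variables (I : Type) (X : I -> lang).
Notation C := (Comp X).
Context {A B D Y Z : Type} {CA : Coded A} {CB : Coded B} {CD : Coded D}
  {CY : Coded Y} {CZ : Coded Z}.

Lemma Comp_map (g : I -> A -> Y -> Z) (l : I -> A -> seq Y) :
  C (fun i p => g i p.1 p.2) -> C l -> C (fun i a => map (g i a) (l i a)).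
Proof.
move=> Hg Hl.
apply: (@Comp_ext _ _ _ _ _ _ (fun i a => foldr (fun y s => g i a y :: s) [::] (l i a))) => //.
by apply: Comp_foldr => //; comp_auto.
Qed.

Lemma Comp_cat (f g : I -> A -> seq Y) : C f -> C g -> C (fun i a => f i a ++ g i a).
Proof.
move=> Hf Hg.
apply: (@Comp_ext _ _ _ _ _ _ (fun i a => foldr cons (g i a) (f i a))).
  by apply: Comp_foldr => //; comp_auto.
by move=> i a; elim: (f i a) => //= y s ->.
Qed.

Lemma Comp_negb (b : I -> A -> bool) : C b -> C (fun i a => ~~ b i a).
Proof. by move=> H; apply: Comp_ext (Comp_if H (Comp_const _ false) (Comp_const _ true)) _. Qed.

Lemma Comp_andb (b c : I -> A -> bool) : C b -> C c -> C (fun i a => b i a && c i a).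
Proof. by move=> H G; apply: Comp_ext (Comp_if H G (Comp_const _ false)) _. Qed.

Lemma Comp_orb (b c : I -> A -> bool) : C b -> C c -> C (fun i a => b i a || c i a).
Proof. by move=> H G; apply: Comp_ext (Comp_if H (Comp_const _ true) G) _. Qed.

Lemma Comp_eqb (b c : I -> A -> bool) : C b -> C c -> C (fun i a => b i a == c i a).
Proof.
move=> H G; apply: Comp_ext (Comp_if H G (Comp_negb G)) _ => i a.
by case: (b i a); case: (c i a).
Qed.

End ListMaps.

Section Booleans.
Variables (I : Type) (X : I -> lang).
Notation C := (Comp X).
Context {A B D Y Z : Type} {CA : Coded A} {CB : Coded B} {CD : Coded D}
  {CY : Coded Y} {CZ : Coded Z}.

Lemma Comp_all (p : I -> A -> Y -> bool) (l : I -> A -> seq Y) :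
  C (fun i q => p i q.1 q.2) -> C l -> C (fun i a => all (p i a) (l i a)).
Proof.
move=> Hp Hl.
apply: (@Comp_ext _ _ _ _ _ _ (fun i a => foldr (fun y b => p i a y && b) true (l i a))) => //.
apply: Comp_foldr => //; last exact: Comp_const.
by apply: Comp_andb; comp_auto.
Qed.

Lemma Comp_size (l : I -> A -> seq Y) : C l -> C (fun i a => size (l i a)).
Proof.
move=> Hl; apply: (@Comp_ext _ _ _ _ _ _ (fun i a => foldr (fun _ n => n.+1) 0 (l i a))) => //.
by apply: Comp_foldr => //; comp_auto.
Qed.

Lemma Comp_behead (l : I -> A -> seq Y) : C l -> C (fun i a => behead (l i a)).
Proof. by move=> Hl; apply: (Comp_lcase Hl); comp_auto. Qed.

Lemma Comp_head (y : I -> A -> Y) (l : I -> A -> seq Y) : C y -> C l ->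
  C (fun i a => head (y i a) (l i a)).
Proof. by move=> Hy Hl; apply: (Comp_lcase Hl); comp_auto. Qed.

End Booleans.

Section ListAccess.
Variables (I : Type) (X : I -> lang).
Notation C := (Comp X).
Context {A B D Y Z : Type} {CA : Coded A} {CB : Coded B} {CD : Coded D}
  {CY : Coded Y} {CZ : Coded Z}.

Lemma Comp_drop (n : I -> A -> nat) (l : I -> A -> seq Y) : C n -> C l ->
  C (fun i a => drop (n i a) (l i a)).
Proof.
move=> Hn Hl.
apply: (@Comp_ext _ _ _ _ _ _ (fun i a => iter (n i a) behead (l i a))).
  by apply: Comp_iter => //; apply: Comp_behead; comp_auto.
move=> i a; elim: (n i a) => [|m IH] /=; first by rewrite drop0.
by rewrite -IH -drop1 drop_drop.
Qed.

Lemma Comp_nth (y : I -> A -> Y) (l : I -> A -> seq Y) (n : I -> A -> nat) :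
  C y -> C l -> C n -> C (fun i a => nth (y i a) (l i a) (n i a)).
Proof.
move=> Hy Hl Hn; apply: (Comp_ext (Comp_head Hy (Comp_drop Hn Hl))) => i a.
by rewrite -nth0 nth_drop addn0.
Qed.

Lemma Comp_zip (l : I -> A -> seq Y) (m : I -> A -> seq Z) : C l -> C m ->
  C (fun i a => zip (l i a) (m i a)).
Proof.
move=> Hl Hm.
pose g (p : seq Z * seq (Y * Z)) y :=
  match p.1 with [::] => p | z :: m' => (m', (y, z) :: p.2) end.
apply: (@Comp_ext _ _ _ _ _ _ (fun i a => rev (foldl g (m i a, [::]) (l i a)).2)).
  by apply: Comp_rev; apply: Comp_snd; apply: Comp_foldl; rewrite /g; comp_auto.
move=> i a; have F r s : foldl g ([::], r) s = ([::], r) by elim: s.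
suff K s t r : rev (foldl g (t, r) s).2 = rev r ++ zip s t by rewrite K.
elim: s t r => [|y s IH] [|z t] r; rewrite ?F ?cats0 //.
by rewrite [foldl _ _ _]/= IH rev_cons cat_rcons.
Qed.

Lemma Comp_add (m n : I -> A -> nat) : C m -> C n -> C (fun i a => m i a + n i a).
Proof.
move=> Hm Hn; apply: (@Comp_ext _ _ _ _ _ _ (fun i a => iter (m i a) succn (n i a))).
  by apply: Comp_iter => //; comp_auto.
by move=> i a; rewrite iter_succn addnC.
Qed.

Lemma Comp_pred (n : I -> A -> nat) : C n -> C (fun i a => (n i a).-1).
Proof. by move=> Hn; apply: (Comp_ncase Hn); comp_auto. Qed.

End ListAccess.

Section Subtraction.
Variables (I : Type) (X : I -> lang).
Notation C := (Comp X).
Context {A B D Y Z : Type} {CA : Coded A} {CB : Coded B} {CD : Coded D}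
  {CY : Coded Y} {CZ : Coded Z}.

Lemma Comp_sub (m n : I -> A -> nat) : C m -> C n -> C (fun i a => m i a - n i a).
Proof.
move=> Hm Hn; apply: (@Comp_ext _ _ _ _ _ _ (fun i a => iter (n i a) predn (m i a))).
  by apply: Comp_iter => //; apply: Comp_pred; comp_auto.
by move=> i a; rewrite iter_predn.
Qed.

End Subtraction.

Section Arithmetic.
Variables (I : Type) (X : I -> lang).
Notation C := (Comp X).
Context {A B D Y Z : Type} {CA : Coded A} {CB : Coded B} {CD : Coded D}
  {CY : Coded Y} {CZ : Coded Z}.

Lemma Comp_mul (m n : I -> A -> nat) : C m -> C n -> C (fun i a => m i a * n i a).
Proof.
move=> Hm Hn; apply: (@Comp_ext _ _ _ _ _ _ (fun i a => iter (n i a) (addn (m i a)) 0)).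
  by apply: Comp_iter => //; [apply: Comp_add|]; comp_auto.
by move=> i a; rewrite iter_addn_0.
Qed.

Lemma Comp_leq (m n : I -> A -> nat) : C m -> C n -> C (fun i a => m i a <= n i a).
Proof.
move=> Hm Hn; apply: (@Comp_ext _ _ _ _ _ _ (fun i a =>
    match m i a - n i a with 0 => true | _.+1 => false end)) => [|i a].
  by apply: Comp_ncase (Comp_sub Hm Hn) _ _; comp_auto.
by rewrite /leq; case: (_ - _).
Qed.

Lemma Comp_rcons (l : I -> A -> seq Y) (y : I -> A -> Y) : C l -> C y ->
  C (fun i a => rcons (l i a) (y i a)).
Proof.
move=> Hl Hy; apply: (Comp_ext (Comp_cat Hl (Comp_cons Hy (Comp_const _ [::])))) => i a.
by rewrite cats1.
Qed.

Lemma Comp_odd (n : I -> A -> nat) : C n -> C (fun i a => odd (n i a)).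
Proof.
move=> Hn; apply: (@Comp_ext _ _ _ _ _ _ (fun i a => iter (n i a) negb false)).
  by apply: Comp_iter => //; [apply: Comp_negb|]; comp_auto.
by move=> i a; elim: (n i a) => //= m ->.
Qed.

Lemma Comp_half (n : I -> A -> nat) : C n -> C (fun i a => (n i a)./2).
Proof.
move=> Hn; apply: (@Comp_ext _ _ _ _ _ _
    (fun i a => (iter (n i a) (fun p => (p.2, p.1.+1)) (0, 0)).1)).
  by apply: Comp_fst; apply: Comp_iter; comp_auto.
move=> i a; rewrite (_ : iter _ _ _ = ((n i a)./2, uphalf (n i a))) //.
by elim: (n i a) => //= m ->.
Qed.

Lemma Comp_iota (m n : I -> A -> nat) : C m -> C n -> C (fun i a => iota (m i a) (n i a)).
Proof.
move=> Hm Hn; apply: (@Comp_ext _ _ _ _ _ _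
    (fun i a => rev (iter (n i a) (fun p => (p.1.+1, p.1 :: p.2)) (m i a, [::])).2)).
  by apply: Comp_rev; apply: Comp_snd; apply: Comp_iter; comp_auto.
move=> i a; rewrite (_ : iter _ _ _ = (m i a + n i a, rev (iota (m i a) (n i a)))) ?revK //.
by elim: (n i a) => [|k IH]; rewrite ?addn0 // iterS IH addnS -[in RHS](addn1 k) iotaD rev_cat.
Qed.

End Arithmetic.

Section Sequences.
Variables (I : Type) (X : I -> lang).
Notation C := (Comp X).
Context {A B D Y Z : Type} {CA : Coded A} {CB : Coded B} {CD : Coded D}
  {CY : Coded Y} {CZ : Coded Z}.

Lemma Comp_exp (m n : I -> A -> nat) : C m -> C n -> C (fun i a => m i a ^ n i a).
Proof.
move=> Hm Hn; apply: (@Comp_ext _ _ _ _ _ _ (fun i a => iter (n i a) (muln (m i a)) 1)).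
  by apply: Comp_iter => //; [apply: Comp_mul|]; comp_auto.
by move=> i a; elim: (n i a) => //= k IH; rewrite expnS IH.
Qed.

Lemma Comp_eqn (m n : I -> A -> nat) : C m -> C n -> C (fun i a => m i a == n i a).
Proof.
move=> Hm Hn; apply: (Comp_ext (Comp_andb (Comp_leq Hm Hn) (Comp_leq Hn Hm))) => i a.
by rewrite eqn_leq.
Qed.

Lemma Comp_mkseq (g : I -> A -> nat -> Y) (n : I -> A -> nat) :
  C (fun i p => g i p.1 p.2) -> C n -> C (fun i a => mkseq (g i a) (n i a)).
Proof. by move=> Hg Hn; apply: Comp_map => //; apply: Comp_iota; comp_auto. Qed.

Lemma Comp_take (n : I -> A -> nat) (l : I -> A -> seq Y) : C n -> C l ->
  C (fun i a => take (n i a) (l i a)).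
Proof.
move=> Hn Hl.
apply: (@Comp_ext _ _ _ _ _ _ (fun i a =>
   rev (drop (size (l i a) - n i a) (rev (l i a))))).
  by apply: Comp_rev; apply: Comp_drop; [apply: Comp_sub => //; apply: Comp_size | apply: Comp_rev].
by move=> i a; rewrite drop_rev revK; case: (leqP (n i a) (size (l i a))) => H;
  [rewrite subKn | rewrite (eqP (ltnW H)) subn0 take_size take_oversize // ltnW].
Qed.

Lemma Comp_nilp (l : I -> A -> seq Y) : C l -> C (fun i a => nilp (l i a)).
Proof.
move=> Hl; apply: (Comp_ext (Comp_lcase Hl (Comp_const _ true) (Comp_const _ false))) => i a.
by case: (l i a).
Qed.

Lemma Comp_odflt (y : I -> A -> Y) (o : I -> A -> option Y) : C y -> C o ->
  C (fun i a => odflt (y i a) (o i a)).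
Proof. by move=> Hy Ho; apply: (Comp_ocase Ho); comp_auto. Qed.

End Sequences.

Ltac comp_ext ::= first
  [ apply: Comp_negb | apply: Comp_andb | apply: Comp_orb | apply: Comp_add | apply: Comp_sub
  | apply: Comp_mul
  | apply: Comp_leq | apply: Comp_exp | apply: Comp_eqb | apply: Comp_eqn
  | apply: Comp_cat | apply: Comp_rcons | apply: Comp_rev | apply: Comp_size | apply: Comp_behead
  | apply: Comp_head | apply: Comp_drop | apply: Comp_take | apply: Comp_nth | apply: Comp_zip
  | apply: Comp_odd | apply: Comp_half | apply: Comp_iota | apply: Comp_pred | apply: Comp_odflt
  | apply: Comp_mkseq | apply: Comp_map | apply: Comp_all | apply: Comp_foldl | apply: Comp_foldr
  | apply: Comp_iter ].

Section Equality.
Variables (I : Type) (X : I -> lang).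
Notation C := (Comp X).
Context {A : Type} {Y Z : eqType} {CA : Coded A} {CY : Coded Y} {CZ : Coded Z}.

Lemma Comp_eqo (f g : I -> A -> option Y) : C (fun _ p => p.1 == p.2 :> Y) ->
  C f -> C g -> C (fun i a => f i a == g i a).
Proof.
move=> E Hf Hg; apply: (@Comp_ext _ _ _ _ _ _ (fun i a =>
  match f i a with
  | None => match g i a with None => true | Some _ => false end
  | Some y => match g i a with None => false | Some z => y == z end
  end)); last by move=> i a; case: (f i a) (g i a) => [y|] [z|].
comp_auto.
by apply: (Comp_comp2 (g := fun _ y z => y == z)) => //; comp_auto.
Qed.

Lemma Comp_eqs (f g : I -> A -> seq Y) : C (fun _ p => p.1 == p.2 :> Y) ->
  C f -> C g -> C (fun i a => f i a == g i a).
Proof.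
move=> E Hf Hg.
pose h (p : seq Y * bool) y :=
  match p.1 with [::] => ([::], false) | z :: s => (s, p.2 && (y == z)) end.
apply: (@Comp_ext _ _ _ _ _ _ (fun i a =>
   (foldl h (g i a, true) (f i a)).2 && nilp (foldl h (g i a, true) (f i a)).1)).
  have H : C (fun i a => foldl h (g i a, true) (f i a)).
    apply: Comp_foldl; rewrite /h; comp_auto.
    by apply: (Comp_comp2 (g := fun _ y z => y == z)) => //; comp_auto.
  by apply: Comp_andb; [|apply: Comp_nilp]; comp_auto; rewrite /h.
move=> i a; have F s : (foldl h ([::], false) s) = ([::], false) by elim: s.
have K b s t : (foldl h (t, b) s).2 && nilp (foldl h (t, b) s).1 = b && (s == t).
  elim: s t b => [|y s IH] [|z t] b /=; rewrite ?andbT ?andbF //.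
    by rewrite /h /= F.
  by rewrite IH eqseq_cons andbA.
by rewrite K.
Qed.

Lemma Comp_eqp (f g : I -> A -> Y * Z) : C (fun _ p => p.1 == p.2 :> Y) ->
  C (fun _ p => p.1 == p.2 :> Z) -> C f -> C g -> C (fun i a => f i a == g i a).
Proof.
move=> E1 E2 Hf Hg; apply: (@Comp_ext _ _ _ _ _ _ (fun i a =>
  ((f i a).1 == (g i a).1) && ((f i a).2 == (g i a).2))).
  by apply: Comp_andb; apply: (Comp_comp2 (g := fun _ y z => y == z)) => //; comp_auto.
by move=> i a; case: (f i a) (g i a) => [y z] [y' z'].
Qed.

End Equality.

Ltac comp_eq ::= first [ apply: Comp_eqo | apply: Comp_eqs | apply: Comp_eqp ].

(** * Search, enumeration and a universal machine *)

Section Search.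
Variables (I : Type) (X : I -> lang).
Notation C := (Comp X).
Context {A B : Type} {CA : Coded A} {CB : Coded B}.

Lemma Comp_search (P : I -> A -> nat -> bool) (f : I -> A -> nat) :
  C (fun i p => P i p.1 p.2) -> (forall i a, P i a (f i a)) ->
  (forall i a m, m < f i a -> ~~ P i a m) -> C f.
Proof.
move=> HP Hf Hmin.
pose step (i : I) (p : A * nat) := (p.1, p.2.+1).
have E i a n : iter n (step i) (a, 0) = (a, n) by elim: n => //= n ->.
have W : C (fun i a => iter (f i a) (step i) (a, 0)).
  apply: (Comp_while (test := fun i p => ~~ P i p.1 p.2));
    [by comp_auto | by rewrite /step; comp_auto | by comp_auto | |].
  - by move=> i a k lt; rewrite E /=; apply: Hmin.
  - by move=> i a; rewrite E /= negbK; apply: Hf.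
by apply: Comp_ext (Comp_snd W) _ => i a; rewrite E.
Qed.

Lemma Comp_nseq (n : I -> A -> nat) (b : I -> A -> B) : C n -> C b ->
  C (fun i a => nseq (n i a) (b i a)).
Proof.
move=> Hn Hb; apply: (@Comp_ext _ _ _ _ _ _ (fun i a => iter (n i a) (cons (b i a)) [::])).
  by comp_auto; apply: (Comp_app Hb); comp_auto.
by move=> i a; elim: (n i a) => //= m ->.
Qed.

End Search.

Ltac comp_user ::= apply: Comp_nseq.

(** Bijective base-two numeration, least significant digit first, with digits 1 and 2. *)
Fixpoint num (w : word) : nat :=
  if w is b :: w' then (num w').*2 + (if b then 2 else 1) else 0.

Fixpoint wsucc (w : word) : word :=
  match w with [::] => [:: false] | false :: w' => true :: w' | true :: w' => false :: wsucc w' end.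

Definition wd (n : nat) : word := iter n wsucc [::].

Lemma num_wsucc w : num (wsucc w) = (num w).+1.
Proof. by elim: w => [|[] w IH] //=; rewrite ?IH; lia. Qed.

Lemma wdK : cancel wd num.
Proof. by elim=> //= n IH; rewrite num_wsucc -/(wd n) IH. Qed.

Lemma num_inj : injective num.
Proof.
elim=> [|b w IH] [|c v] //=; try by case: ifP => _; lia.
by case: b c => [] [] H; do ?[congr (_ :: _); apply: IH]; lia.
Qed.

Lemma numK : cancel num wd.
Proof. by move=> w; apply: num_inj; rewrite wdK. Qed.

Lemma size_wsucc w : size w <= size (wsucc w).
Proof. by elim: w => [|[] w IH]. Qed.

Lemma size_wd m n : m <= n -> size (wd m) <= size (wd n).
Proof.
move=> /subnK <-; elim: (n - m) => //= k IH.
exact: leq_trans IH (size_wsucc _).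
Qed.

Lemma pure_num : Pure num.
Proof.
move=> I X.
apply: (@Comp_ext _ _ _ _ _ _ (fun _ w =>
   foldr (fun b n => n + n + (if b then 2 else 1)) 0 w)); first by comp_auto.
by move=> _; elim=> //= b w ->; rewrite addnn.
Qed.

Lemma pure_wd : Pure wd.
Proof.
move=> I X; apply: Comp_iter; comp_auto.
(* The successor sometimes keeps the tail unchanged, so the fold carries both the word and its
   successor. *)
apply: (@Comp_ext _ _ _ _ _ _ (fun _ p =>
  (foldr (fun b q => (b :: q.1, if b then false :: q.2 else true :: q.1))
     ([::], [:: false]) p.2).2)); first by comp_auto.
move=> _ [a w] /=; rewrite (_ : foldr _ _ _ = (w, wsucc w)) //.
by elim: w {a} => //= b w ->; case: b.
Qed.

(** Read from right to left, a preorder code is a postfix expression, evaluated here with a stack of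
    trees. Malformed words also yield some tree, so every number enumerates an object. *)
Definition parse_step (b : bool) (st : seq tree) : seq tree :=
  if b then match st with
    | [::] => [::]
    | x :: st' => match st' with [::] => [::] | y :: st'' => Node x y :: st'' end
    end
  else Leaf :: st.
Definition parse (w : word) : tree := head Leaf (foldr parse_step [::] w).

Lemma codeK : cancel code parse.
Proof.
move=> t; rewrite /parse -[code t]cats0.
suff -> w : foldr parse_step [::] (code t ++ w) = t :: foldr parse_step [::] w by [].
by elim: t w => [|a IHa b IHb] w //=; rewrite -catA IHa IHb.
Qed.

Lemma pure_parse : Pure parse.
Proof. by move=> I X; rewrite /parse /parse_step; comp_auto. Qed.

Class Decodable A {CA : Coded A} := pure_dec : Pure (dec : tree -> A).

#[export] Instance bool_decodable : Decodable (A := bool).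
Proof. by move=> I X; apply: Comp_tcase; comp_auto. Qed.

Lemma Comp_spine I (X : I -> lang) : Comp X (fun _ t => spine t).
Proof. by apply: Comp_cast (Comp_id _) _ => i t /=; elim: t => //= a _ b ->. Qed.

#[export] Instance nat_decodable : Decodable (A := nat).
Proof. by move=> I X; apply: Comp_size; apply: Comp_spine. Qed.

Section DecodableConstructors.
Context {A B : Type} {CA : Coded A} {CB : Coded B} {DA : Decodable (A := A)}
  {DB : Decodable (A := B)}.

#[export] Instance prod_decodable : Decodable (A := A * B).
Proof.
have HA := @pure_dec A CA DA; have HB := @pure_dec B CB DB.
by move=> I X; apply: Comp_tcase; comp_auto.
Qed.

#[export] Instance option_decodable : Decodable (A := option A).
Proof.
by have HA := @pure_dec A CA DA; move=> I X; apply: Comp_tcase; comp_auto.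
Qed.

#[export] Instance seq_decodable : Decodable (A := seq A).
Proof.
have HA := @pure_dec A CA DA.
by move=> I X; apply: Comp_map; comp_auto; apply: Comp_spine.
Qed.

End DecodableConstructors.

Definition enumerate (A : Type) {CA : Coded A} (k : nat) : A := dec (parse (wd k)).

Lemma enumerate_surj (A : Type) {CA : Coded A} (a : A) : exists k, enumerate k = a.
Proof. by exists (num (code (enc a))); rewrite /enumerate numK codeK encK. Qed.

Lemma pure_enumerate (A : Type) {CA : Coded A} {DA : Decodable (A := A)} :
  Pure (@enumerate A _).
Proof.
have H := @pure_dec A CA DA; have H1 := pure_wd; have H2 := pure_parse.
by move=> I X; rewrite /enumerate; comp_auto.
Qed.

Section SelectFirst.
Context {A B : Type} {CA : Coded A} {CB : Coded B} {DB : Decodable (A := B)}.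

(** Existence may be known only classically; since the test is computable, the first witness in the
    enumeration is a computable choice. *)
Lemma pure_select (P : A -> B -> bool) :
  Pure (fun p => P p.1 p.2) -> (forall a, exists b, P a b) ->
  exists2 f : A -> B, Pure f & forall a, P a (f a).
Proof.
move=> HP ex.
have ex' a : exists k, P a (enumerate k).
  by have [b Hb] := ex a; have [k Ek] := enumerate_surj b; exists k; rewrite Ek.
have He := @pure_enumerate B CB DB.
exists (fun a => enumerate (ex_minn (ex' a))); last by move=> a; case: ex_minnP.
move=> I X; apply: (Comp_pure He).
apply: (@Comp_search _ _ _ _ (fun _ a k => P a (enumerate k))); comp_auto.
- by move=> _ a; case: ex_minnP.
- move=> _ a m; case: ex_minnP => k _ min lt; apply/negP => /min.
  by rewrite leqNgt lt.
Qed.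

End SelectFirst.

Definition mrow := ((nat * seq sym) * (nat * seq (sym * option bool)))%type.
(* [(qs, n, rows)]: special states (start, query, yes, no, accept, reject), number of tapes,
   transition table. *)
Definition mcode := (seq nat * nat * seq mrow)%type.
Definition mconfig := (nat * seq tape)%type.

Definition sp (e : mcode) k := nth 0 e.1.1 k.
Definition chalted (e : mcode) (c : mconfig) := (c.1 == sp e 4) || (c.1 == sp e 5).

Definition cmove (m : option bool) (t : tape) : tape :=
  match m with
  | None => t
  | Some b => if b then (head None t.2 :: t.1, behead t.2)
              else match t.1 with [::] => t | a :: l => (l, a :: t.2) end
  end.

Definition lookup (tb : seq mrow) (key : nat * seq sym) :=
  foldr (fun row r => if row.1 == key then row.2 else r) (0, [::]) tb.

(** Total on every code: a missing row gives state 0 and no actions, whereupon [zip] drops all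
    tapes. Arbitrary codes can therefore be simulated and diagonalised against. *)
Definition cstep (X : lang) (e : mcode) (c : mconfig) : mconfig :=
  if chalted e c then c
  else if c.1 == sp e 1 then
    ((if X (tape_word (nth ([::], [::]) c.2 1)) then sp e 2 else sp e 3), c.2)
  else
    let r := lookup e.2 (c.1, map tape_read c.2) in
    (r.1, map (fun p => cmove p.1.2 (tape_write p.1.1 p.2)) (zip r.2 c.2)).

Definition cinit (e : mcode) (x : word) : mconfig :=
  (sp e 0, ([::], map Some x) :: nseq e.1.2.-1 ([::], [::])).

Definition crun (e : mcode) (X : lang) (x : word) (t : nat) : mconfig :=
  iter t (cstep X e) (cinit e x).

Definition sim (e : mcode) (X : lang) (x : word) (t : nat) : option bool :=
  let c := crun e X x t in if chalted e c then Some (c.1 == sp e 4) else None.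

Section StepComputable.
Variables (I : Type) (X : I -> lang).
Notation C := (Comp X).
Context {A : Type} {CA : Coded A}.

Lemma pure_tape_word : Pure tape_word.
Proof.
move=> J Y; apply: (@Comp_ext _ _ _ _ _ _ (fun _ t =>
  foldr (fun a w => match a with Some b => b :: w | None => [::] end) [::] (rev t.1 ++ t.2))).
  by comp_auto.
by move=> _ t; rewrite /tape_word; elim: (rev t.1 ++ t.2) => //= [[b|]] s ->.
Qed.

(** The oracle may depend on the argument: simulations use both the actual oracle and oracles given
    by a finite word. *)
Lemma Comp_cstep (e : I -> A -> mcode) (orc : I -> A -> word -> bool) (c : I -> A -> mconfig) :
  C e -> C (fun i p => orc i p.1 p.2) -> C c ->
  C (fun i a => cstep (orc i a) (e i a) (c i a)).
Proof.
move=> He Ho Hc; have Hw := pure_tape_word.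
rewrite /cstep /chalted /lookup /sp /tape_read /tape_write /cmove /=.
by comp_auto.
Qed.

End StepComputable.

Section SimComputable.
Variables (I : Type) (X : I -> lang).
Notation C := (Comp X).
Context {A : Type} {CA : Coded A}.

Lemma Comp_sim (e : I -> A -> mcode) (orc : I -> A -> word -> bool) (x : I -> A -> word)
    (t : I -> A -> nat) :
  C e -> C (fun i p => orc i p.1 p.2) -> C x -> C t ->
  C (fun i a => sim (e i a) (orc i a) (x i a) (t i a)).
Proof.
move=> He Ho Hx Ht.
have Hr : C (fun i a => crun (e i a) (orc i a) (x i a) (t i a)).
  by apply: Comp_iter; [comp_auto | apply: Comp_cstep; comp_auto | rewrite /cinit /sp; comp_auto].
by rewrite /sim /chalted /sp; comp_auto.
Qed.

End SimComputable.

(** * Locality and universality of the simulation *)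

Lemma cstep_halted X e c : chalted e c -> cstep X e c = c.
Proof. by rewrite /cstep => ->. Qed.

Lemma sim_mono X e x t t' b : sim e X x t = Some b -> t <= t' -> sim e X x t' = Some b.
Proof.
rewrite /sim; case: ifP => // H [<-] le; rewrite /crun -(subnK le) iterD -/(crun e X x t).
suff -> : iter (t' - t) (cstep X e) (crun e X x t) = crun e X x t by rewrite H.
by elim: (t' - t) => //= n ->; rewrite cstep_halted.
Qed.

Lemma sim_fun X e x t t' b b' : sim e X x t = Some b -> sim e X x t' = Some b' -> b = b'.
Proof.
case: (leqP t t') => [|/ltnW] le H H'.
  by move: (sim_mono H le); rewrite H' => -[].
by move: (sim_mono H' le); rewrite H => -[].
Qed.

Definition tsize (t : tape) := size t.1 + size t.2.

Lemma size_bits_prefix s : size (bits_prefix s) <= size s.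
Proof. by elim: s => [|[b|] s IH]. Qed.

Lemma size_tape_word t : size (tape_word t) <= tsize t.
Proof.
by apply: leq_trans (size_bits_prefix _) _; rewrite size_cat size_rev.
Qed.

Lemma tsize_act m s t : tsize (cmove m (tape_write s t)) <= (tsize t).+1.
Proof.
have W : tsize (tape_write s t) <= (tsize t).+1.
  by case: t => l [|a r]; rewrite /tsize /=; lia.
case: m => [[]|] //=; apply: leq_trans W; rewrite /tsize /=; first lia.
by case: t => [[|a l] r] /=; lia.
Qed.

Definition qtape (c : mconfig) : tape := nth ([::], [::]) c.2 1.

Lemma tsize_cstep X e c : tsize (qtape (cstep X e c)) <= (tsize (qtape c)).+1.
Proof.
rewrite /cstep; case: ifP => // _; case: ifP => // _; rewrite /qtape /=.
move: (lookup _ _).2 => r.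
case: (ltnP 1 (size (zip r c.2))) => lt; last by rewrite nth_default ?size_map.
rewrite (nth_map ((None, None), ([::], [::]))) // nth_zip_cond lt /=.
exact: tsize_act.
Qed.

Lemma tsize_crun X e x t : tsize (qtape (crun e X x t)) <= t.
Proof.
elim: t => [|t IH]; last exact: leq_trans (tsize_cstep _ _ _) _.
by rewrite /qtape /= nth_nseq if_same.
Qed.

(** The query tape starts empty and grows by at most one cell per step, so [t] steps can only ask
    about words shorter than [t]. *)
Lemma sim_local X Y e x t :
  (forall w, size w < t -> X w = Y w) -> sim e X x t = sim e Y x t.
Proof.
move=> E; rewrite /sim; suff -> : crun e X x t = crun e Y x t by [].
elim: t E => //= t IH E.
rewrite -/(crun e X x t) -/(crun e Y x t) -IH; last by move=> w lt; apply: E; apply: ltnW.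
rewrite /cstep E // ltnS.
exact: leq_trans (size_tape_word _) (tsize_crun _ _ _ _).
Qed.

Section CodeOfMachine.
Variable M : OTM.
Let nt := (nw M).+2.
Local Notation readings := {ffun 'I_nt -> sym}.

Definition mv (m : move) : option bool :=
  match m with MoveS => None | MoveL => Some false | MoveR => Some true end.

Lemma cmove_mv m t : cmove (mv m) t = tape_move m t.
Proof. by case: m. Qed.

Definition row_key (u : 'I_(ns M) * readings) : nat * seq sym :=
  (val u.1, [seq u.2 i | i <- enum 'I_nt]).
Definition row_val (u : 'I_(ns M) * readings) : nat * seq (sym * option bool) :=
  let d := delta u.1 u.2 in (val d.1, [seq ((d.2 i).1, mv (d.2 i).2) | i <- enum 'I_nt]).

Definition mcode_of : mcode :=
  ([:: val (q_start M); val (q_query M); val (q_yes M); val (q_no M); val (q_acc M);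
       val (q_rej M)], nt,
   [seq (row_key u, row_val u) | u <- enum {: 'I_(ns M) * readings}]).

Lemma row_key_inj : injective row_key.
Proof.
move=> [q r] [q' r'] [/val_inj -> /eq_in_map E]; congr (_, _).
by apply/ffunP => i; apply: E; rewrite mem_enum.
Qed.

Lemma lookup_row u : lookup mcode_of.2 (row_key u) = row_val u.
Proof.
rewrite /lookup /=; have: u \in enum {: 'I_(ns M) * readings} by rewrite mem_enum.
elim: (enum _) => //= v s IH; rewrite inE (inj_eq row_key_inj) eq_sym.
by case: eqP => [->|_] //=.
Qed.

Definition abstract (c : config M) : mconfig := (val c.1, [seq c.2 i | i <- enum 'I_nt]).

Lemma abstract_halted c : chalted mcode_of (abstract c) = halted c.
Proof. by rewrite /chalted /halted /sp /= !(inj_eq val_inj). Qed.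

Lemma abstract_step X c : cstep X mcode_of (abstract c) = abstract (step X c).
Proof.
rewrite /cstep abstract_halted /step; case: ifP => // _.
rewrite {1}/sp /= (inj_eq val_inj); case: ifP => _.
  have -> : nth ([::], [::]) [seq c.2 i | i <- enum 'I_nt] 1 = c.2 (query_tape M).
    rewrite (nth_map ord0) ?size_enum_ord //.
    by congr (c.2 _); apply: (nth_ord_enum ord0 (query_tape M)).
  by rewrite /abstract /=; case: ifP.
pose r : readings := [ffun i => tape_read (c.2 i)].
have -> : (val c.1, [seq tape_read i | i <- [seq c.2 i | i <- enum 'I_nt]]) =
    row_key (c.1, r).
  by rewrite /row_key /= -map_comp; congr (_, _); apply: eq_map => i; rewrite /= ffunE.
rewrite lookup_row /abstract /=; congr (_, _).
rewrite -/r; elim: (enum 'I_nt) => //= i s ->.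
by rewrite cmove_mv.
Qed.

Lemma abstract_init x : abstract (init M x) = cinit mcode_of x.
Proof.
rewrite /abstract /cinit /sp /=; congr (_, _).
rewrite enum_ordSl /=; congr (_ :: _).
rewrite -map_comp (eq_map (g := fun _ => ([::], [::]))) //.
have -> s : [seq ([::], [::]) : tape | _ <- s : seq 'I_(nw M).+1] = nseq (size s) ([::], [::]).
  by elim: s => //= a s ->.
by rewrite size_enum_ord.
Qed.

Lemma abstract_run X x t : crun mcode_of X x t = abstract (run M X x t).
Proof.
elim: t => [|t IH]; first by rewrite abstract_init.
by rewrite /crun /run !iterS -/(crun _ _ _ _) IH abstract_step.
Qed.

Lemma sim_outputs X x t b :
  sim mcode_of X x t = Some b <-> outputs_within M X x t b.
Proof.
rewrite /sim abstract_run abstract_halted /outputs_within {1}/sp /= (inj_eq val_inj).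
by case: ifP => H; split=> [[]|[] // _ ->].
Qed.

End CodeOfMachine.

Definition cdecides (e : mcode) (X L : lang) := forall x, exists t, sim e X x t = Some (L x).

Lemma decides_cdecides M X L : decides M X L <-> cdecides (mcode_of M) X L.
Proof. by split=> H x; have [t Ht] := H x; exists t; apply/sim_outputs. Qed.

Section Reductions.
Variables (I : Type) (X : I -> lang).

(** Transitivity of reducibility, uniformly in the index: the halting time is found by search, and
    the answer does not depend on the time found. *)
Lemma Comp_relay e (B L : I -> lang) :
  Comp X B -> (forall i, cdecides e (B i) (L i)) -> Comp X L.
Proof.
move=> HB H.
have ex i x : exists t, sim e (B i) x t != None.
  by have [t Ht] := H i x; exists t; rewrite Ht.
have S : Comp X (fun i p => sim e (B i) p.1 p.2).
  by apply: (Comp_sim (orc := fun i _ => B i)); comp_auto.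
have F : Comp X (fun i x => ex_minn (ex i x)).
  apply: (@Comp_search _ _ _ _ (fun i x t => sim e (B i) x t != None)).
  - by apply: Comp_negb; apply: (@Comp_ext _ _ _ _ _ _ (fun i p => match sim e (B i) p.1 p.2 with
      None => true | Some _ => false end)); [comp_auto | move=> i p; case: sim].
  - by move=> i x; case: ex_minnP.
  - move=> i x m; case: ex_minnP => k _ min lt; apply/negP => /min.
    by rewrite leqNgt lt.
apply: (@Comp_ext _ _ _ _ _ _ (fun i x => odflt false (sim e (B i) x (ex_minn (ex i x))))).
  apply: Comp_odflt; first exact: Comp_const.
  by apply: (Comp_comp2 (g := fun i x t => sim e (B i) x t)) => //; apply: Comp_id.
move=> i x; case: ex_minnP => k; case E: sim => [b|] // _ _.
by have [t Ht] := H i x; rewrite (sim_fun Ht E).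
Qed.

Lemma Comp_cdecided e (L : I -> lang) : (forall i, cdecides e (X i) (L i)) -> Comp X L.
Proof. by apply: Comp_relay; apply: Comp_query; apply: Comp_id. Qed.

End Reductions.

(** * Trees as Lipschitz maps *)

Notation point := (nat -> bool).

(** The tree is the range of [ap h], and [Z] is the parameter of the branch. *)
Definition ap (h : word -> bool) (Z : point) : point := fun n => h (mkseq Z n.+1).
Definition oracle (Y : point) : lang := fun w => Y (num w).
Definition pad (g : word) : point := nth false g.
(** A run of [horizon n] steps queries only words numbered below [n], so [n] bits of the parameter
    determine it. *)
Definition horizon (n : nat) : nat := size (wd n).
Definition compose (h k : word -> bool) : word -> bool :=
  fun g => h (mkseq (fun i => k (take i.+1 g)) (size g)).

Lemma take_mkseq (Z : point) m n : m <= n -> take m (mkseq Z n) = mkseq Z m.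
Proof. by move=> le; rewrite /mkseq -map_take take_iota (minn_idPl le). Qed.

Lemma eq_in_mkseq (Y Z : point) n : (forall i, i < n -> Y i = Z i) -> mkseq Y n = mkseq Z n.
Proof. by move=> E; apply/eq_in_map => i; rewrite mem_iota => /andP[_]; apply: E. Qed.

Lemma mkseq_pad g : mkseq (pad g) (size g) = g.
Proof. exact: mkseq_nth. Qed.

Lemma ap_compose h k Z : ap (compose h k) Z = ap h (ap k Z).
Proof.
apply: functional_extensionality => n; rewrite /ap /compose size_mkseq.
congr h; apply/eq_in_map => i; rewrite mem_iota add0n => /andP[_ lt].
by rewrite take_mkseq.
Qed.

Lemma pure_compose h k : Pure h -> Pure k -> Pure (compose h k).
Proof. by move=> Hh Hk I X; rewrite /compose; comp_auto. Qed.

Lemma size_lt_num w n : size w < horizon n -> num w < n.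
Proof.
by rewrite ltnNge; apply: contraR; rewrite -leqNgt => /size_wd; rewrite numK.
Qed.

(** The time limit is such that the padding bits are never consulted; a value found on [g] thus
    holds on every branch whose parameter extends [g]. *)
Definition eval (e : mcode) (h : word -> bool) (g x : word) : option bool :=
  sim e (oracle (ap h (pad g))) x (horizon (size g)).

Lemma pure_eval e h : Pure h -> Pure (fun p => eval e h p.1 p.2).
Proof.
move=> Hh I X; have Hn := pure_num; have Hw := pure_wd; rewrite /eval /horizon /oracle /ap /pad.
by apply: (Comp_sim (orc := fun _ p w => h (mkseq (nth false p.1) (num w).+1))); comp_auto.
Qed.

Lemma eval_mkseq e h Z n x :
  eval e h (mkseq Z n) x = sim e (oracle (ap h Z)) x (horizon n).
Proof.
rewrite /eval size_mkseq; apply: sim_local => w /size_lt_num lt.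
rewrite /oracle /ap; congr h; apply: eq_in_mkseq => i le.
by rewrite /pad nth_mkseq // (leq_trans le).
Qed.

Lemma eval_cat e h g d x b : eval e h g x = Some b -> eval e h (g ++ d) x = Some b.
Proof.
set Z := pad (g ++ d).
have Eg : mkseq Z (size g) = g.
  by rewrite -[RHS]mkseq_pad; apply: eq_in_mkseq => i lt; rewrite /Z /pad nth_cat lt.
rewrite -{1}Eg -[g ++ d]mkseq_pad !eval_mkseq => /sim_mono; apply.
by apply: size_wd; rewrite size_cat leq_addr.
Qed.

Lemma eval_lim e h Z x t b : sim e (oracle (ap h Z)) x t = Some b ->
  exists N, forall n, N <= n -> eval e h (mkseq Z n) x = Some b.
Proof.
move=> H; exists (num (nseq t false)) => n le; rewrite eval_mkseq; apply: sim_mono H _.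
(* The witness is the number of a word of length [t], so its horizon is [t]. *)
by have := size_wd le; rewrite numK size_nseq.
Qed.

(** Injectivity guarantees that a tree has two distinct branches, hence a way to avoid any given
    set. *)
Definition cond (h : word -> bool) :=
  Pure h /\ forall Z Z', ap h Z = ap h Z' -> Z = Z'.

Lemma cond_compose h k : cond h -> cond k -> cond (compose h k).
Proof.
move=> [Ph Ih] [Pk Ik]; split; first exact: pure_compose.
by move=> Z Z'; rewrite !ap_compose => /Ih/Ik.
Qed.

Definition prepend (b : word) (Z : point) : point :=
  fun n => if n < size b then nth false b n else Z (n - size b).

(** Restriction to the parameters that begin with [b], in Lipschitz form; a nonempty [b] moreover
    delays the bits of the parameter. *)
Definition shift (b g : word) : bool := nth false (b ++ g) (size g).-1.

Lemma ap_shift b Z : ap (shift b) Z = prepend b Z.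
Proof.
apply: functional_extensionality => n; rewrite /ap /shift size_mkseq nth_cat /prepend.
by case: ifP => // _; rewrite nth_mkseq // ltnS leq_subr.
Qed.

Lemma mkseq_prepend b Z n : mkseq (prepend b Z) (size b + n) = b ++ mkseq Z n.
Proof.
apply: (@eq_from_nth _ false); rewrite ?size_cat ?size_mkseq // => i lt.
rewrite nth_mkseq // nth_cat /prepend; case: ltnP => // le.
by rewrite nth_mkseq // ltn_subLR.
Qed.

Lemma cond_shift b : cond (shift b).
Proof.
split; first by move=> I X; rewrite /shift; comp_auto.
move=> Z Z'; rewrite !ap_shift => E; apply: functional_extensionality => n.
have := congr1 (fun Y : point => Y (size b + n)) E.
by rewrite /prepend ltnNge leq_addr /= addKn.
Qed.

Lemma eval_lim_prepend e h b Z x t c : sim e (oracle (ap h (prepend b Z))) x t = Some c ->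
  exists g, eval e h (b ++ g) x = Some c.
Proof.
move=> /eval_lim[N H]; exists (mkseq Z N); rewrite -mkseq_prepend; apply: H.
exact: leq_addl.
Qed.

(** Two branches differ at some position [n], where one of them disagrees with [B]; the first [n.+1]
    bits of its parameter fix that disagreement. *)
Lemma avoid h (B : lang) : cond h -> exists b, forall Z, oracle (ap h (prepend b Z)) <> B.
Proof.
move=> [_ inj].
have [n Hn] : exists n, ap h (fun=> false) n <> ap h (fun=> true) n.
  apply: NNPP => N; have : (fun _ : nat => false) = (fun=> true).
    apply: inj; apply: functional_extensionality => n; apply: NNPP => Hn.
    by apply: N; exists n.
  by move/(congr1 (fun Y : point => Y 0)).
have [Y HY] : exists Y, ap h Y n <> B (wd n).
  case: (ap h (fun=> false) n =P B (wd n)) => E; last by exists (fun=> false).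
  by exists (fun=> true) => E'; apply: Hn; rewrite E E'.
exists (mkseq Y n.+1) => Z E; apply: HY; rewrite -E /oracle wdK /ap.
have := mkseq_prepend (mkseq Y n.+1) Z 0; rewrite addn0 cats0 size_mkseq => ->.
by [].
Qed.

Lemma pure_computable (L : lang) : Pure L -> computable L.
Proof.
move=> H; have [M HM] := Comp_decides (H unit (fun=> no_oracle)).
by exists M; apply: (HM tt).
Qed.

Lemma treducible_trans A B D : treducible A B -> treducible B D -> treducible A D.
Proof.
move=> [M1 H1] [M2 H2].
have HB : Comp (fun _ : unit => D) (fun _ => B).
  by apply: (@Comp_cdecided _ _ (mcode_of M2)) => _; apply/decides_cdecides.
have HA : Comp (fun _ : unit => D) (fun _ => A).
  by apply: (@Comp_relay _ _ (mcode_of M1) _ _ HB) => _; apply/decides_cdecides.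
by have [M HM] := Comp_decides HA; exists M; apply: (HM tt).
Qed.

(** An opponent then carries one exponent instead of a polynomial. The base is at least 2, so a
    power of it absorbs the coefficients even at 0. *)
Lemma peval_le cs : exists c, forall n, peval cs n <= (n + 2) ^ c.
Proof.
exists (sumn cs + size cs) => n; rewrite expnD.
apply: (@leq_trans (sumn cs * (n + 2) ^ size cs)).
  rewrite /peval sumnE (big_nth 0) big_mkord big_distrl /=.
  apply: leq_sum => i _; rewrite leq_mul2l; apply/orP; right.
  apply: (@leq_trans ((n + 2) ^ i)); last by rewrite leq_pexp2l ?addn2 // ltnW.
  by case: (nat_of_ord i) => // k; rewrite leq_exp2r // leq_addr.
rewrite leq_mul2r; apply/orP; right; apply: ltnW.
apply: leq_trans (ltn_expl (sumn cs) (isT : 1 < 2)) _.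
by case: (sumn cs) => // s; rewrite leq_exp2r // leq_addl.
Qed.

(** * Compactness of Cantor space *)

Fixpoint words (m : nat) : seq word :=
  if m is n.+1 then map (cons false) (words n) ++ map (cons true) (words n) else [:: [::]].

Lemma mem_words g : g \in words (size g).
Proof.
elim: g => [|b g IH] //=; rewrite mem_cat.
by case: b; apply/orP; [right|left]; apply: map_f.
Qed.

Lemma size_words m g : g \in words m -> size g = m.
Proof.
elim: m g => [|m IH] g /=; first by rewrite inE => /eqP->.
by rewrite mem_cat => /orP[] /mapP[d /IH <- ->].
Qed.

Lemma pure_words : Pure words.
Proof.
move=> I X; apply: (@Comp_ext _ _ _ _ _ _ (fun _ m =>
  iter m (fun l => map (cons false) l ++ map (cons true) l) [:: [::]])).
  by comp_auto.
by move=> _; elim=> //= m ->.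
Qed.

(** König's lemma: if no level is entirely good, follow words with bad extensions at every depth,
    turning to [true] only when [false] fails; the path contradicts the bar. *)
Lemma compactness (good : word -> bool) :
  (forall g d, good g -> good (g ++ d)) ->
  (forall Z : point, exists n, good (mkseq Z n)) ->
  exists m, forall g, size g = m -> good g.
Proof.
move=> up bar; apply: NNPP => nofan.
pose bad g := forall m, exists2 d, size d = m & ~~ good (g ++ d).
have bad0 : bad [::].
  move=> m; apply: NNPP => N; apply: nofan; exists m => g Eg.
  by apply: contraT => ng; case: N; exists g.
have badS g : bad g -> ~ bad (rcons g false) -> bad (rcons g true).
  move=> bg nb m; have [m' Hm'] : exists m', forall d, size d = m' -> good (rcons g false ++ d).
    apply: NNPP => N; apply: nb => m'; apply: NNPP => N'; apply: N; exists m' => d Ed.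
    by apply: contraT => nd; case: N'; exists d.
  (* One bit more than both depths: after [false], the next [m'] bits would force goodness, so the
     extension begins with [true] and can be cut at depth [m]. *)
  have [[|b d] /= Ed nd] := bg (maxn m m').+1 => //; case: Ed => Ed.
  case: b nd => nd.
    exists (take m d); first by rewrite size_takel // Ed leq_maxl.
    apply: contra nd => /(@up _ (drop m d)).
    by rewrite -catA cat_take_drop cat_rcons.
  have : good (rcons g false ++ take m' d).
    by apply: Hm'; rewrite size_takel // Ed leq_maxr.
  move/(@up _ (drop m' d)); rewrite -catA cat_take_drop cat_rcons.
  by rewrite (negbTE nd).
pose next g := rcons g (if excluded_middle_informative (bad (rcons g false)) then false else true).
pose path n := iter n next [::].
have bad_path n : bad (path n).
  elim: n => //= n IH; rewrite /next; case: excluded_middle_informative => // nb.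
  exact: badS.
have size_path n : size (path n) = n by elim: n => //= n IH; rewrite size_rcons IH.
pose Z n := nth false (path n.+1) n.
have EZ n : mkseq Z n = path n.
  elim: n => // n IH; rewrite mkseqS IH /Z /= -/(path n) /next.
  by rewrite nth_rcons size_path ltnn eqxx.
have [n] := bar Z; rewrite EZ => gn.
have [d] := bad_path n 0; case: d => // _; rewrite cats0.
by rewrite gn.
Qed.

(** * Forcing *)

Definition opponent (w : word) : mcode * nat := dec (parse w).

Lemma pure_opponent : Pure opponent.
Proof.
by move=> I X; apply: (Comp_pure pure_dec); apply: (Comp_pure pure_parse); apply: Comp_id.
Qed.

Lemma opponent_surj d : exists w, opponent w = d.
Proof. by exists (code (enc d)); rewrite /opponent codeK encK. Qed.

(** * Recovering the parameter, and thinning against lowness for speed *)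

Section Recover.
Variables (psi : word -> bool) (X : word -> word) (V : word -> bool).
Hypotheses (Ppsi : Pure psi) (PX : Pure X) (PV : Pure V).
(** [X g] will be the word on which the node of [g] splits, and [V g] the value on its [true]
    side. *)
Hypothesis recover : forall Z n,
  Z n = (oracle (ap psi Z) (X (mkseq Z n)) == V (mkseq Z n)).

Lemma recover_inj Z Z' : ap psi Z = ap psi Z' -> Z = Z'.
Proof.
move=> E; suff K n : mkseq Z n = mkseq Z' n.
  by apply: functional_extensionality => n; rewrite recover [RHS]recover E K.
by elim: n => // n IH; rewrite !mkseqS IH recover [Z' n]recover E IH.
Qed.

Lemma Comp_recover : Comp (fun Z => oracle (ap psi Z)) (fun Z n => mkseq Z n).
Proof.
apply: (@Comp_ext _ _ _ _ _ _ (fun Z n =>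
  iter n (fun g => rcons g (oracle (ap psi Z) (X g) == V g)) [::])).
  have Q : Comp (fun Z => oracle (ap psi Z)) (fun Z w => oracle (ap psi Z) w).
    by apply: Comp_query; apply: Comp_id.
  apply: Comp_iter; [by comp_auto| |by comp_auto].
  apply: Comp_rcons; first by comp_auto.
  by apply: Comp_eqb; [apply: (Comp_app Q)|]; comp_auto.
by move=> Z; elim=> // n IH; rewrite mkseqS recover IH.
Qed.

Lemma recover_treducible h Z : Pure h -> treducible (oracle (ap h Z)) (oracle (ap psi Z)).
Proof.
move=> Ph; have R := Comp_recover; have Pn := pure_num.
have H : Comp (fun Z => oracle (ap psi Z)) (fun Z w => oracle (ap h Z) w).
  rewrite /oracle /ap; apply: (Comp_pure Ph).
  apply: (Comp_app (f := fun _ w => (num w).+1) R); comp_auto.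
by have [M HM] := Comp_decides H; exists M.
Qed.

(* The answer of the recovering machine to [w] is the bit of [Z] at position [2 num w], which the
   thinned tree [k] sets to [L w]; the remaining bits of [Z] move to odd positions. *)
Lemma thin_not_low : exists2 k, cond k & forall Z, ~ low_for_speed (oracle (ap psi (ap k Z))).
Proof.
have Pn := pure_num; have Pw := pure_wd.
have [N HN] : exists N, forall Z, decides N (oracle (ap psi Z)) (fun w => Z (num w).*2).
  apply: Comp_decides; apply: (@Comp_ext _ _ _ _ _ _ (fun Z w =>
    nth false (mkseq Z (num w + num w).+1) (num w + num w))).
    apply: Comp_nth; [by comp_auto| | by comp_auto].
    by apply: (Comp_app (f := fun _ w => (num w + num w).+1) Comp_recover); comp_auto.
  by move=> Z w; rewrite addnn nth_mkseq.
pose e := mcode_of N.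
(* A bound valid for all parameters at once is a finite check, since [eval] consults only [g]. *)
pose fast (w : word) m := all (fun g => eval e psi g w != None) (words m).
have Pe := pure_eval e Ppsi; have Pws := pure_words.
have [T PT HT] : exists2 T, Pure T & forall w, fast w (T w).
  apply: pure_select.
    move=> I Y; rewrite /fast; apply: Comp_all; last by comp_auto.
    apply: (@Comp_ext _ _ _ _ _ _ (fun _ p => match eval e psi p.2 p.1.1 with
      None => false | Some _ => true end)); first by comp_auto.
    by move=> _ p; case: eval.
  move=> w; have [|Z|m Hm] := @compactness (fun g => eval e psi g w != None).
  - by move=> g d; case E: eval => [b|] // _; rewrite (eval_cat d E).
  - have [t /sim_outputs/eval_lim[n /(_ n (leqnn n)) E]] := HN Z w.
    by exists n; rewrite E.
  - by exists m; apply/allP => g /size_words; apply: Hm.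
pose S w := horizon (T w).
have simS Z w : sim e (oracle (ap psi Z)) w (S w) = Some (Z (num w).*2).
  have mw : mkseq Z (T w) \in words (T w).
    by have := mem_words (mkseq Z (T w)); rewrite size_mkseq.
  have := allP (HT w) _ mw; rewrite eval_mkseq -/(S w); case E: sim => [b|] // _.
  by have [t /sim_outputs H] := HN Z w; rewrite (sim_fun E H).
(* [None] means that the opponent exceeds its time on [w], so any value defeats it. *)
pose L w := match sim (opponent w).1 no_oracle w ((S w + 2) ^ (opponent w).2) with
  Some b => ~~ b | None => false end.
have PL : Pure L.
  move=> I Y; have Po := pure_opponent; rewrite /L; apply: Comp_ocase; [|by comp_auto|by comp_auto].
  apply: (Comp_sim (orc := fun _ _ _ => false)); rewrite /S /horizon; comp_auto.
pose k g := let n := (size g).-1 in if odd n then nth false g n./2 else L (wd n./2).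
have Ek Z n : ap k Z n = if odd n then Z n./2 else L (wd n./2).
  rewrite /ap /k size_mkseq /=; case: ifP => // _; rewrite nth_mkseq //.
  by rewrite ltnS; lia.
exists k.
  split; first by move=> I Y; rewrite /k; comp_auto.
  move=> Z Z' E; apply: functional_extensionality => n.
  have := congr1 (fun Y : point => Y n.*2.+1) E.
  by rewrite !Ek /= odd_double /= uphalf_double.
move=> Z low.
have EL w : ap k Z (num w).*2 = L w by rewrite Ek odd_double doubleK numK.
have [|M' [cs HM']] := low L (pure_computable PL) N S.
  by move=> w; apply/sim_outputs; rewrite simS EL.
have [c Hc] := peval_le cs.
(* The diagonal word: there [L] negates the answer of the very machine that lowness provides. *)
have [w Ew] := opponent_surj (mcode_of M', c).
have /sim_outputs E := HM' w.
have {}E := sim_mono E (Hc (S w)).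
have : L w = ~~ L w by rewrite {1}/L Ew /= E.
by case: (L w).
Qed.

End Recover.

Definition settled (e : mcode) (A : lang) := forall B, cdecides e A B ->
  computable B \/ treducible A B /\ ~ low_for_speed B.

Lemma cdecides_fun e A B B' : cdecides e A B -> cdecides e A B' -> B = B'.
Proof.
move=> H H'; apply: functional_extensionality => w.
have [t E] := H w; have [t' E'] := H' w; exact: sim_fun E E'.
Qed.

(** * Settling one machine below a given tree *)

Section Settle.
Variables (e : mcode) (h : word -> bool).
Hypothesis ch : cond h.
Let ev := eval e h.

Lemma pure_ev : Pure (fun p => ev p.1 p.2).
Proof. exact: pure_eval ch.1. Qed.

Lemma settle_divergent b x : (forall g, ev (b ++ g) x = None) ->
  forall Z, settled e (oracle (ap h (ap (shift b) Z))).
Proof.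
move=> div Z B H; have [t] := H x; rewrite ap_shift => /eval_lim_prepend[g].
by rewrite -/(ev _ _) div.
Qed.

(** All values found above [b] agree, so [B] is computed by searching for any convergent extension;
    [conv] makes the search end. *)
Lemma settle_constant b :
  (forall g x, exists d, ev (g ++ d) x != None) ->
  (forall g d x, ev (b ++ g) x != None -> ev (b ++ d) x != None -> ev (b ++ g) x = ev (b ++ d) x) ->
  forall Z, settled e (oracle (ap h (ap (shift b) Z))).
Proof.
move=> conv const Z B H; left; have Pe := pure_ev.
have Ptest : Pure (fun p : word * word => ev (b ++ p.2) p.1 != None).
  move=> I Y; apply: (@Comp_ext _ _ _ _ _ _ (fun _ p => match ev (b ++ p.2) p.1 with
      None => false | Some _ => true end)); first by comp_auto.
  by move=> _ p; case: ev.
have [f Pf Hf] := pure_select (P := fun x g => ev (b ++ g) x != None) Ptest (conv b).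
have -> : B = fun x => odflt false (ev (b ++ f x) x).
  apply: functional_extensionality => x.
  have [t] := H x; rewrite ap_shift => /eval_lim_prepend[g E].
  by rewrite (const _ g) ?Hf // /ev E.
by apply: pure_computable => I Y; comp_auto.
Qed.

Definition splits (g : word) (q : word * word * word) : bool :=
  match ev (g ++ q.1.1) q.2 with
  | None => false
  | Some b => match ev (g ++ q.1.2) q.2 with None => false | Some c => b != c end
  end.

Section Splitting.
Variables (s : word -> word * word * word) (cv : word -> word -> word).
Hypotheses (Ps : Pure s) (Pcv : Pure (fun p => cv p.1 p.2)).
Hypotheses (Hs : forall g, splits g (s g)) (Hcv : forall g x, ev (g ++ cv g x) x != None).

(* Node [g] at level [n] is split, then extended until the computation on word number [n]
   converges. *)
Definition grow (st : word * nat) (i : bool) : word * nat :=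
  let g := st.1 ++ (if i then (s st.1).1.2 else (s st.1).1.1) in
  (rcons (g ++ cv g (wd st.2)) false, st.2.+1).
Definition node (z : word) : word := (foldl grow ([::], 0) z).1.

Lemma grow_level z : (foldl grow ([::], 0) z).2 = size z.
Proof. by elim/last_ind: z => // z i IH; rewrite foldl_rcons size_rcons -IH. Qed.

Lemma node_rcons z i : exists2 d,
  node (rcons z i) = node z ++ (if i then (s (node z)).1.2 else (s (node z)).1.1) ++ rcons d false &
  ev (node (rcons z i)) (wd (size z)) != None.
Proof.
rewrite /node foldl_rcons /grow grow_level /= -/(node z).
set q := (if i then _ else _); set g := node z ++ q.
exists (cv g (wd (size z))); first by rewrite rcons_cat /g -catA.
have := Hcv g (wd (size z)); case E: ev => [c|] // _.
by rewrite -cats1 /ev (eval_cat _ E).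
Qed.

(** The closing [false] in [grow] lengthens every level, so the first [n.+1] bits of the parameter
    determine bit [n] of the subtree, as the Lipschitz form demands. *)
Lemma size_node z : size z <= size (node z).
Proof.
elim/last_ind: z => // z i IH; have [d -> _] := node_rcons z i.
rewrite size_rcons !size_cat size_rcons; lia.
Qed.

Lemma node_cat z y : exists d, node (z ++ y) = node z ++ d.
Proof.
elim/last_ind: y => [|y i [d IH]]; first by exists [::]; rewrite !cats0.
rewrite -rcons_cat; have [d' -> _] := node_rcons (z ++ y) i.
by rewrite IH -catA; eexists.
Qed.

Definition subtree (z : word) : bool := nth false (node z) (size z).-1.

Lemma subtree_node Z n :
  mkseq (ap subtree Z) (size (node (mkseq Z n))) = node (mkseq Z n).
Proof.
rewrite -[RHS](mkseq_pad); apply: eq_in_mkseq => i lt.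
rewrite /ap /subtree size_mkseq /pad /=.
have le : i < size (node (mkseq Z i.+1)) by have := size_node (mkseq Z i.+1); rewrite size_mkseq.
have X m n' : m <= n' -> i < size (node (mkseq Z m)) ->
    nth false (node (mkseq Z n')) i = nth false (node (mkseq Z m)) i.
  move=> mn lm; rewrite -(take_mkseq Z mn) in lm *.
  have [d E] := node_cat (take m (mkseq Z n')) (drop m (mkseq Z n')).
  by rewrite cat_take_drop in E; rewrite E nth_cat lm.
by case: (leqP i.+1 n) => [|/ltnW] mn; [symmetry|]; apply: X.
Qed.

(** The set computed by [e], in Lipschitz form: a node of level [n.+1] was extended until word
    number [n] converged. *)
Definition image (z : word) : bool := odflt false (ev (node z) (wd (size z).-1)).

Lemma sim_node Z n x b : ev (node (mkseq Z n)) x = Some b ->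
  exists t, sim e (oracle (ap h (ap subtree Z))) x t = Some b.
Proof. by rewrite -subtree_node /ev eval_mkseq => E; eexists; apply: E. Qed.

Lemma cdecides_image Z : cdecides e (oracle (ap h (ap subtree Z))) (oracle (ap image Z)).
Proof.
move=> w; apply: (@sim_node _ (num w).+1).
have [_ _] := node_rcons (mkseq Z (num w)) (Z (num w)).
rewrite -mkseqS size_mkseq numK => conv'.
rewrite /oracle /ap /image size_mkseq -pred_Sn numK.
by case: ev conv'.
Qed.

Definition split_word (z : word) : word := (s (node z)).2.
Definition split_value (z : word) : bool :=
  odflt false (ev (node z ++ (s (node z)).1.2) (split_word z)).

Lemma image_recover Z n :
  Z n = (oracle (ap image Z) (split_word (mkseq Z n)) == split_value (mkseq Z n)).
Proof.
set z := mkseq Z n; have := Hs (node z); rewrite /splits /split_value -/(split_word z).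
case E0: ev => [b0|] //; case E1: ev => [b1|] //= neq.
have [d Ed _] := node_rcons z (Z n).
(* The next node extends the side chosen by [Z n] and inherits its value; as the two values differ,
   comparison with the [true] side reads off the bit. *)
have : ev (node (rcons z (Z n))) (split_word z) = Some (if Z n then b1 else b0).
  by rewrite Ed catA; case: (Z n); apply: eval_cat.
rewrite -mkseqS => /sim_node[t Et].
have [t' Et'] := cdecides_image Z (split_word z).
rewrite (sim_fun Et' Et); case: (Z n); first by rewrite eqxx.
by rewrite (negbTE neq).
Qed.

Lemma pure_node : Pure node.
Proof. by have Pw := pure_wd; move=> I Y; rewrite /node /grow; comp_auto. Qed.

Lemma settle_splitting :
  exists2 k, cond k & forall Z, settled e (oracle (ap h (ap k Z))).
Proof.
have Pn := pure_node; have Pe := pure_ev; have Pw := pure_wd; have [Ph _] := ch.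
have Pi : Pure image by move=> I Y; rewrite /image; comp_auto.
have Px : Pure split_word by move=> I Y; rewrite /split_word; comp_auto.
have Pv : Pure split_value by move=> I Y; rewrite /split_value; comp_auto.
have Pt : Pure subtree by move=> I Y; rewrite /subtree; comp_auto.
have [k ck Hk] := thin_not_low Pi Px Pv image_recover.
exists (compose subtree k).
  (* Injectivity of [subtree]: equal branches compute the same set, and that set determines the
     parameter. *)
  apply: cond_compose ck; split=> // Z Z' E; apply: (recover_inj image_recover).
  have : oracle (ap image Z) = oracle (ap image Z').
    by apply: (@cdecides_fun e) (cdecides_image Z) _; rewrite E; apply: cdecides_image.
  move=> EI; apply: functional_extensionality => n.
  by have := congr1 (fun L : lang => L (wd n)) EI; rewrite /oracle wdK.
move=> Z B H; right; rewrite ap_compose in H *.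
rewrite -(cdecides_fun (cdecides_image _) H); split; last exact: Hk.
rewrite -(ap_compose h subtree); apply: (recover_treducible Px Pv image_recover).
exact: pure_compose.
Qed.

End Splitting.

Lemma settle : exists2 k, cond k & forall Z, settled e (oracle (ap h (ap k Z))).
Proof.
have Pe := pure_ev.
case: (classic (exists b x, forall g, ev (b ++ g) x = None)) => [[b [x div]]|ndiv].
  by exists (shift b); [apply: cond_shift | apply: settle_divergent div].
have conv g x : exists d, ev (g ++ d) x != None.
  apply: NNPP => N; apply: ndiv; exists g, x => d.
  by case E: ev => [c|] //; case: N; exists d; rewrite E.
case: (classic (exists b, forall g q, ~~ splits b (g, q.1, q.2))) => [[b const]|split].
  exists (shift b); first exact: cond_shift.
  apply: settle_constant => // g d x; have := const g (d, x); rewrite /splits /=.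
  by case: ev => [c|] //; case: ev => [c'|] //; rewrite negbK => /eqP->.
have ex g : exists q, splits g q.
  apply: NNPP => N; apply: split; exists g => d q; apply/negP => H.
  by apply: N; exists (d, q.1, q.2).
have Psp : Pure (fun p => splits p.1 p.2).
  by move=> I Y; rewrite /splits; comp_auto.
have [s Ps Hs] := pure_select Psp ex.
have [cv Pcv Hcv] : exists2 cv : word * word -> word, Pure cv &
    forall p, ev (p.1 ++ cv p) p.2 != None.
  apply: (pure_select (P := fun p d => ev (p.1 ++ d) p.2 != None)) => // I Y.
  apply: (@Comp_ext _ _ _ _ _ _ (fun _ p => match ev (p.1.1 ++ p.2) p.1.2 with
      None => false | Some _ => true end)); first by comp_auto.
  by move=> _ p; case: ev.
apply: (@settle_splitting s (fun g x => cv (g, x))) => //.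
  by move=> I Y; comp_auto.
by move=> g x; apply: (Hcv (g, x)).
Qed.

End Settle.

(** * A branch that meets all requirements *)

Definition forced (e : mcode) (A : lang) := ~ cdecides e no_oracle A /\ settled e A.

Lemma force e h : cond h -> exists2 k, cond k & forall Z, forced e (oracle (ap h (ap k Z))).
Proof.
move=> ch; have [k ck Hk] := settle e ch.
have chk := cond_compose ch ck.
(* A code decides at most one set without oracle, so there is a single set to avoid. *)
have [B HB] : exists B, forall A, cdecides e no_oracle A -> A = B.
  case: (classic (exists A, cdecides e no_oracle A)) => [[B HB]|N].
    by exists B => A HA; apply: cdecides_fun HA HB.
  by exists no_oracle => A HA; case: N; exists A.
have [b Hb] := avoid B chk.
exists (compose k (shift b)); first exact: cond_compose ck (cond_shift b).
move=> Z; rewrite ap_compose; split; last exact: Hk.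
by move=> /HB; rewrite -ap_compose ap_shift; apply: Hb.
Qed.

(* If the [j]-th bit of [J n Z] depends only on the first [j] bits of [Z], then infinite
   compositions of the maps [J n] converge, without any compactness argument. *)
Section Limit.
Variable J : nat -> point -> point.
Hypothesis strict : forall n j Y Z, (forall i, i < j -> Y i = Z i) -> J n Y j = J n Z j.

Fixpoint tower (n m : nat) (Z : point) : point :=
  if m is m'.+1 then J n (tower n.+1 m' Z) else Z.

Lemma tower_agree n m Y Z i : i < m -> tower n m Y i = tower n m Z i.
Proof.
elim: m n i => // m IH n i le /=; apply: strict => j lt.
by apply: IH; apply: leq_trans lt _.
Qed.

Lemma tower_add n a b Z : tower n (a + b) Z = tower n a (tower (n + a) b Z).
Proof. by elim: a n => [|a IH] n /=; rewrite ?addn0 // IH addSnnS. Qed.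

(** Each level makes one more bit independent of the starting point, so [j.+1] levels fix bit
    [j]. *)
Definition limit n : point := fun j => tower n j.+1 (fun=> false) j.

Lemma limit_step n : J n (limit n.+1) = limit n.
Proof.
apply: functional_extensionality => j.
rewrite -[RHS]/(J n (tower n.+1 j (fun=> false)) j); apply: strict => i lt.
by rewrite /limit -(subnKC lt) tower_add; apply: tower_agree.
Qed.

End Limit.

Lemma generic : exists A, forall e, forced e A.
Proof.
have [en en_surj] : exists en : nat -> mcode, forall e, exists n, en n = e.
  by eexists; apply: enumerate_surj.
pose cnd := {h | cond h}.
have nxt (h : cnd) e : {k | cond k /\ forall Z, forced e (oracle (ap (sval h) (ap k Z)))}.
  apply: constructive_indefinite_description.
  by have [k ck Hk] := force e (svalP h); exists k.
(* The added [shift] delays the parameter by one bit, which turns a Lipschitz map into one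
   satisfying [strict]. *)
pose j (h : cnd) n := compose (sval (nxt h (en n))) (shift [:: false]).
have cj h n : cond (j h n).
  by apply: cond_compose (cond_shift _); apply: (svalP (nxt h (en n))).1.
pose next n (h : cnd) : cnd := exist _ _ (cond_compose (svalP h) (cj h n)).
pose H := fix H n : cnd := if n is m.+1 then next m (H m) else exist _ _ (cond_shift [::]).
pose J n := ap (j (H n) n).
have strict n i Y Z : (forall l, l < i -> Y l = Z l) -> J n Y i = J n Z i.
  move=> E; rewrite /J /j !ap_compose !ap_shift /ap; congr (sval _ _).
  by apply: eq_in_mkseq => -[|l] //= lt; rewrite /prepend /= subn1; apply: E.
pose Z := limit J.
have EA n : ap (sval (H n)) (Z n) = ap (sval (H 0)) (Z 0).
  elim: n => // n <-; rewrite [H n.+1]/= /next [sval _]/= ap_compose.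
  by rewrite -/(J n) limit_step.
exists (oracle (ap (sval (H 0)) (Z 0))) => e.
(* One more unfolding of the limit puts the parameter of stage [n] in the range of the map that
   forces [en n]. *)
have [n <-] := en_surj e; rewrite -(EA n) /Z -(limit_step strict n).
rewrite /J /j ap_compose; exact: (svalP (nxt (H n) (en n))).2.
Qed.

Theorem theorem5p9 :
  exists A : lang, minimal_degree A /\
    forall B : lang, treducible B A -> ~ computable B -> ~ degree_in_LFSstar B.
Proof.
have [A HA] := generic.
have set B : treducible B A -> computable B \/ treducible A B /\ ~ low_for_speed B.
  by move=> [M /decides_cdecides H]; apply: (HA (mcode_of M)).2.
exists A; split.
  split; last by move=> B /set[|[]]; [left | right].
  by move=> [M /decides_cdecides]; apply: (HA (mcode_of M)).1.
(* The low for speed member [D] of the degree of [B] is itself below [A], so the dichotomy is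
   applied to [D]. *)
move=> B BA _ [D [[DB _] [ncD low]]].
by case: (set D (treducible_trans DB BA)) => // -[].
Qed.
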